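(* Let $u:\mathbb{R}^2\to\mathbb{R}$ be a smooth solution of the Liouville equation $$\Delta u+e^{2u}=0\quad\text{in }\mathbb{R}^2 .$$ Then the diameter of $\mathbb{R}^2$ under the metric $g=e^{2u}\delta$ satisfies $\mathrm{diam}_g(\mathbb{R}^2)\ge \pi$.
   Context: $\delta$ is the Euclidean metric on $\mathbb{R}^2$. For a Riemannian metric $g$ on $\mathbb{R}^2$, $d_g(x,y)$ is the infimum of the $g$-lengths of piecewise smooth curves from $x$ to $y$ (for $g=e^{2u}\delta$ the length of $\gamma:[a,b]\to\mathbb{R}^2$ is $\int_a^b e^{u(\gamma(t))}|\gamma'(t)|\,dt$), and $\mathrm{diam}_g(\mathbb{R}^2)=\sup_{x,y\in\mathbb{R}^2} d_g(x,y)\in[0,\infty]$. The metric $g$ need not be complete. *)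

(* Defs.v *)
From Stdlib Require Import Reals.
From Coquelicot Require Import Coquelicot.
Open Scope R_scope.

(* [ex_diff_n u k x y] says that [u] and all its iterated partial derivatives
   of order at most [k] exist and are continuous at [(x, y)]. *)
Definition smooth2 (u : R -> R -> R) : Prop :=
  forall (k : nat) (x y : R), ex_diff_n u k x y.

Definition laplacian (u : R -> R -> R) (x y : R) : R :=
  partial_derive 2 0 u x y + partial_derive 0 2 u x y.

Definition smooth1 (p : R -> R) : Prop :=
  forall (k : nat) (t : R), ex_derive_n p k t.

(* Smoothness on a closed piece means smoothness up to the endpoints, expressed
   by a smooth extension to [R].  Consecutive pieces share their endpoints, so
   such a curve is continuous on [[a, b]].  Its values outside [[a, b]] are
   irrelevant. *)
Definition piecewise_smooth (c : R -> R * R) (a b : R) : Prop :=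
  exists (n : nat) (s : nat -> R),
    s 0%nat = a /\ s n = b /\
    (forall i : nat, (i < n)%nat -> s i < s (S i)) /\
    (forall i : nat, (i < n)%nat ->
       exists p q : R -> R, smooth1 p /\ smooth1 q /\
         forall t : R, s i <= t <= s (S i) -> c t = (p t, q t)).

(* Length for the metric [exp (2 u)] times the Euclidean one.  [Derive] is
   meaningless at the finitely many breakpoints, where the value of the
   integrand does not affect the integral. *)
Definition conf_length (u : R -> R -> R) (c : R -> R * R) (a b : R) : R :=
  RInt (fun t => exp (u (fst (c t)) (snd (c t))) *
                 sqrt (Derive (fun r => fst (c r)) t ^ 2 +
                       Derive (fun r => snd (c r)) t ^ 2)) a b.

Definition conf_dist (u : R -> R -> R) (x y : R * R) : Rbar :=
  Glb_Rbar (fun l : R => exists (c : R -> R * R) (a b : R),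
    a < b /\ piecewise_smooth c a b /\ c a = x /\ c b = y /\
    l = conf_length u c a b).

Definition conf_diam (u : R -> R -> R) : Rbar :=
  Rbar_lub (fun d : Rbar => exists x y : R * R, d = conf_dist u x y).

(* Main.v *)
Require Import Defs.
From Stdlib Require Import Reals Lra Lia IndefiniteDescription.
From Coquelicot Require Import Coquelicot.
Open Scope R_scope.

(** The curvature of the metric [exp (2 u)] times the Euclidean one is 1, so the
    plane is developed isometrically onto part of the unit sphere of R^3.  Let
    [a] be the height function of that developing map, relative to the axis
    through the image of the origin.  With [b] and [c] the components of the
    axis along the two unit tangent directions, [(a, b, c)] is a unit vector
    satisfying a linear system with skew-symmetric coefficients
    ([sphere_frame]); the Liouville equation is exactly the compatibility
    condition that makes the system solvable ([sphere_frame_exists]).  Working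
    with the single function [a] replaces the developing map altogether.

    The gradient of [a] has [g]-norm [sqrt (1 - a^2)], so [asin a], the latitude
    of the image point, is 1-Lipschitz for the distance of the metric.  As
    [asin] is singular at the poles, the argument uses [asin (l * a)] with
    [0 < l < 1], which is smooth and still 1-Lipschitz ([dist_ge_asin]).

    It remains to see that [a], which is 1 at the origin, comes arbitrarily
    close to -1 ([sphere_frame_reaches_antipode]).  In complex terms, if the
    image of the developing map missed a cap around the south pole, then
    stereographic projection from that pole would make it a bounded entire
    function, hence constant.  In real terms, [1 / (1 + a)], which is an affine
    function of the squared modulus of that projection, would be a bounded
    function on the plane with positive Laplacian; comparison with the
    logarithm excludes this ([subharmonic_unbounded]).  Taking points of height
    close to -1 and letting [l] tend to 1, the distance from the origin has
    supremum at least [PI / 2 + PI / 2]. *)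

(** * Linear differential equations *)

Lemma mean_value_bound (f df : R -> R) (a b K : R) :
  (forall t, Rmin a b <= t <= Rmax a b -> is_derive f t (df t)) ->
  (forall t, Rmin a b <= t <= Rmax a b -> Rabs (df t) <= K) ->
  Rabs (f b - f a) <= K * Rabs (b - a).
Proof.
  intros hd hb.
  destruct (MVT_gen f a b df) as [c [hc e]].
  - intros t ht; apply hd; lra.
  - intros t ht; apply continuity_pt_filterlim.
    apply (ex_derive_continuous f); exists (df t); apply hd; exact ht.
  - rewrite e, Rabs_mult; apply Rmult_le_compat_r; [apply Rabs_pos | now apply hb].
Qed.

Lemma nonneg_derivative_le (f df : R -> R) (a b : R) :
  a <= b ->
  (forall t, a <= t <= b -> is_derive f t (df t)) ->
  (forall t, a <= t <= b -> 0 <= df t) -> f a <= f b.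
Proof.
  intros hab hd hp.
  destruct (MVT_gen f a b df) as [c [hc e]];
    rewrite ?Rmin_left, ?Rmax_right in * by exact hab.
  - intros t ht; apply hd; lra.
  - intros t ht; apply continuity_pt_filterlim.
    apply (ex_derive_continuous f); exists (df t); apply hd; exact ht.
  - assert (0 <= df c * (b - a)); [apply Rmult_le_pos; [now apply hp | lra] | lra].
Qed.

Lemma is_derive_primitive (f : R -> R) (t : R) :
  (forall z, continuous f z) -> is_derive (fun x => RInt f 0 x) t (f t).
Proof.
  intros hf; apply (is_derive_RInt f _ 0); [| apply hf].
  apply filter_forall; intros x; apply (RInt_correct (V := R_CompleteNormedModule)).
  apply (ex_RInt_continuous (V := R_CompleteNormedModule)); auto.
Qed.

Lemma exp_monotone (x y : R) : x <= y -> exp x <= exp y.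
Proof. intros [h | ->]; [left; now apply exp_increasing | lra]. Qed.

Lemma sign_times_abs (t : R) : exists sg, (sg = 1 \/ sg = -1) /\ t = sg * Rabs t.
Proof.
  destruct (Rle_dec 0 t); [exists 1 | exists (-1)]; split; auto.
  - rewrite Rabs_pos_eq; lra.
  - rewrite Rabs_left; lra.
Qed.

Lemma continuous_sum_n (f : nat -> R -> R) (d : nat) (t : R) :
  (forall j, (j <= d)%nat -> continuous (f j) t) ->
  continuous (fun s => sum_n (fun j => f j s) d) t.
Proof.
  induction d as [|d IH]; intros h.
  - apply continuous_ext with (f 0%nat).
    + now intros s; rewrite sum_O.
    + now apply h.
  - apply continuous_ext with (fun s => plus (sum_n (fun j => f j s) d) (f (S d) s)).
    + now intros s; rewrite sum_Sn.
    + apply (continuous_plus (fun s => sum_n (fun j => f j s) d)); [apply IH | apply h]; auto.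
Qed.

Lemma sum_n_Rminus (a b : nat -> R) (d : nat) :
  sum_n (fun j => a j - b j) d = sum_n a d - sum_n b d.
Proof.
  induction d as [|d IH]; [now rewrite !sum_O |].
  rewrite !sum_Sn, IH; unfold plus; simpl; ring.
Qed.

Lemma sum_n_mult_le (a b : nat -> R) (B : R) (d : nat) :
  (forall j, (j <= d)%nat -> Rabs (b j) <= B) ->
  Rabs (sum_n (fun j => a j * b j) d) <= sum_n (fun j => Rabs (a j)) d * B.
Proof.
  induction d as [|d IH]; intros h.
  - rewrite !sum_O, Rabs_mult.
    apply Rmult_le_compat_l; [apply Rabs_pos | now apply h].
  - rewrite !sum_Sn; unfold plus; simpl.
    eapply Rle_trans; [apply Rabs_triang |].
    rewrite Rmult_plus_distr_r, (Rabs_mult (a (S d))).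
    apply Rplus_le_compat; [apply IH; auto |].
    apply Rmult_le_compat_l; [apply Rabs_pos | now apply h].
Qed.

Lemma sum_n_nonneg_term (a : nat -> R) (d i : nat) :
  (forall j, 0 <= a j) -> (i <= d)%nat -> a i <= sum_n a d.
Proof.
  intros ha; induction d as [|d IH]; intros hi.
  - replace i with 0%nat by lia; rewrite sum_O; lra.
  - rewrite sum_Sn; unfold plus; simpl.
    assert (hs : forall n, 0 <= sum_n a n).
    { induction n as [|n IHn]; [rewrite sum_O; apply ha |].
      rewrite sum_Sn; unfold plus; simpl; specialize (ha (S n)); lra. }
    destruct (Nat.eq_dec i (S d)) as [-> | ne].
    + specialize (hs d); lra.
    + specialize (ha (S d)); assert (a i <= sum_n a d) by (apply IH; lia); lra.
Qed.

Lemma geometric_ex_series (T : nat -> R) (C : R) :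
  (forall n, Rabs (T n) <= C * (1 / 2) ^ n) -> ex_series T.
Proof.
  intros h; apply ex_series_Rabs.
  apply (ex_series_le (K := R_AbsRing) (V := R_CompleteNormedModule))
    with (fun n => C * (1 / 2) ^ n).
  - intros n; unfold norm; simpl; unfold abs; simpl; rewrite Rabs_Rabsolu; apply h.
  - apply (ex_series_scal (V := R_NormedModule) C (fun n => (1 / 2) ^ n)).
    apply ex_series_geom; rewrite Rabs_pos_eq; lra.
Qed.

Lemma geometric_tail (T : nat -> R) (C : R) (N : nat) :
  (forall n, Rabs (T n) <= C * (1 / 2) ^ n) ->
  Rabs (Series T - sum_n T N) <= C * (1 / 2) ^ N.
Proof.
  intros h.
  assert (hT : ex_series (fun n => Rabs (T n))).
  { apply geometric_ex_series with C; intros n; rewrite Rabs_Rabsolu; apply h. }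
  rewrite (Series_incr_n T (S N)) by (lia || exact (ex_series_Rabs _ hT)).
  rewrite sum_n_Reals; simpl pred.
  replace (_ + _ - _) with (Series (fun k => T (S N + k)%nat)) by ring.
  eapply Rle_trans; [apply Series_Rabs |].
  - exact (proj1 (ex_series_incr_n (fun n => Rabs (T n)) (S N)) hT).
  - assert (hs : is_series (fun k => C * (1 / 2) ^ (S N + k)) (C * (1 / 2) ^ N)).
    { replace (C * (1 / 2) ^ N) with ((C * (1 / 2) ^ S N) * / (1 - 1 / 2))
        by (simpl; field).
      apply is_series_ext with (fun k => scal (C * (1 / 2) ^ S N) ((1 / 2) ^ k)).
      - intros k; rewrite pow_add; unfold scal; simpl; unfold mult; simpl; ring.
      - apply (is_series_scal (C * (1 / 2) ^ S N) (fun k => (1 / 2) ^ k)).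
        apply is_series_geom; rewrite Rabs_pos_eq; lra. }
    rewrite <- (is_series_unique _ _ hs).
    apply Series_le; [| eexists; exact hs].
    intros k; split; [apply Rabs_pos | apply h].
Qed.

(** The [n]-th term of the Picard series of [F' = M F], [F 0 = v], in dimension
    [d + 1]: each term is the primitive of [M] applied to the previous one. *)
Fixpoint picard_term (M : nat -> nat -> R -> R) (d : nat) (v : nat -> R)
    (n i : nat) (t : R) : R :=
  match n with
  | 0%nat => v i
  | S m => RInt (fun s => sum_n (fun j => M i j s * picard_term M d v m j s) d) 0 t
  end.

Section Picard.
Variables (M : nat -> nat -> R -> R) (d : nat) (v : nat -> R).
Hypothesis hM : forall i j t, (i <= d)%nat -> (j <= d)%nat -> continuous (M i j) t.

Lemma picard_term_continuous n i t :
  (i <= d)%nat -> continuous (picard_term M d v n i) t.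
Proof.
  revert i t; induction n as [|n IH]; intros i t hi; simpl.
  - apply continuous_const.
  - apply (ex_derive_continuous (V := R_NormedModule)
      (fun x => RInt (fun s => sum_n (fun j => M i j s * picard_term M d v n j s) d) 0 x)).
    eexists; apply is_derive_primitive; intros z.
    apply (continuous_sum_n (fun j s => _)); intros j hj.
    apply (continuous_mult (M i j)); auto.
Qed.

Lemma picard_term_derive n i t :
  (i <= d)%nat ->
  is_derive (picard_term M d v (S n) i) t
    (sum_n (fun j => M i j t * picard_term M d v n j t) d).
Proof.
  intros hi.
  apply (is_derive_primitive (fun s => sum_n (fun j => M i j s * picard_term M d v n j s) d)).
  intros z; apply (continuous_sum_n (fun j s => _)); intros j hj.
  apply (continuous_mult (M i j)); [| apply picard_term_continuous]; auto.
Qed.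

(** The weight [exp (2 K |t|)] grows so fast that integrating [K] times it
    returns at most half of it; this gives the factor [1 / 2] per term, hence
    geometric convergence on every bounded interval. *)
Lemma picard_term_bound (K C L : R) n i t :
  0 < K ->
  (forall i s, (i <= d)%nat -> Rabs s <= L -> sum_n (fun j => Rabs (M i j s)) d <= K) ->
  (forall i, (i <= d)%nat -> Rabs (v i) <= C) ->
  (i <= d)%nat -> Rabs t <= L ->
  Rabs (picard_term M d v n i t) <= C * (1 / 2) ^ n * exp (2 * K * Rabs t).
Proof.
  intros hK hrow hC.
  assert (hC0 : 0 <= C) by (eapply Rle_trans; [apply Rabs_pos | apply (hC 0%nat); lia]).
  revert i t; induction n as [|n IH]; intros i t hi ht.
  - simpl picard_term; rewrite pow_O, Rmult_1_r.
    assert (1 <= exp (2 * K * Rabs t)).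
    { eapply Rle_trans; [| apply exp_ineq1_le].
      assert (0 <= K * Rabs t) by (apply Rmult_le_pos; [lra | apply Rabs_pos]); lra. }
    specialize (hC i hi); nra.
  - set (B := C * (1 / 2) ^ n).
    assert (hB : 0 <= B) by (apply Rmult_le_pos; [lra | apply pow_le; lra]).
    set (f := picard_term M d v (S n) i).
    set (df := fun s => sum_n (fun j => M i j s * picard_term M d v n j s) d).
    assert (hf0 : f 0 = 0).
    { unfold f; simpl; apply (RInt_point (V := R_CompleteNormedModule)). }
    assert (hdf : forall s, Rabs s <= L -> Rabs (df s) <= K * (B * exp (2 * K * Rabs s))).
    { intros s hs; eapply Rle_trans.
      - apply sum_n_mult_le; intros j hj; apply (IH j s hj hs).
      - apply Rmult_le_compat_r; [| now apply hrow].
        apply Rmult_le_pos; [exact hB | left; apply exp_pos]. }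
    replace (C * (1 / 2) ^ S n * exp (2 * K * Rabs t))
      with (B / 2 * exp (2 * K * Rabs t)) by (unfold B; simpl; field).
    assert (main : forall sg r, (sg = 1 \/ sg = -1) -> 0 <= r <= L ->
              forall e, (e = 1 \/ e = -1) ->
              0 <= B / 2 * (exp (2 * K * r) - 1) + e * f (sg * r)).
    { intros sg r hsg hr e he.
      replace 0 with (B / 2 * (exp (2 * K * 0) - 1) + e * f (sg * 0)) at 1
        by (rewrite !Rmult_0_r, exp_0, hf0; ring).
      apply (nonneg_derivative_le
        (fun x => B / 2 * (exp (2 * K * x) - 1) + e * f (sg * x))
        (fun x => K * (B * exp (2 * K * x)) + e * (sg * df (sg * x)))); [lra | |].
      - intros x hx.
        assert (hfx := picard_term_derive n i (sg * x) hi).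
        fold f in hfx; fold (df (sg * x)) in hfx.
        apply (is_derive_plus (fun x => B / 2 * (exp (2 * K * x) - 1))).
        + auto_derive; [trivial | field].
        + apply (is_derive_scal (fun x => f (sg * x)) x e).
          apply (is_derive_comp f (fun x => sg * x)); [exact hfx |].
          auto_derive; [trivial | ring].
      - intros x hx.
        assert (hs : Rabs (sg * x) = x).
        { destruct hsg as [-> | ->]; [rewrite Rmult_1_l; apply Rabs_pos_eq; lra |].
          replace (-1 * x) with (- x) by ring; rewrite Rabs_Ropp; apply Rabs_pos_eq; lra. }
        assert (hd := hdf (sg * x)); rewrite hs in hd.
        specialize (hd ltac:(lra)); apply Rabs_le_between in hd.
        destruct hsg as [-> | ->], he as [-> | ->]; lra. }
    destruct (sign_times_abs t) as [sg [hsg et]].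
    assert (h1 := main sg (Rabs t) hsg (conj (Rabs_pos t) ht) 1 (or_introl eq_refl)).
    assert (h2 := main sg (Rabs t) hsg (conj (Rabs_pos t) ht) (-1) (or_intror eq_refl)).
    rewrite <- et in h1, h2.
    apply Rabs_le; lra.
Qed.

Lemma row_sums_locally_bounded (L : R) : 0 < L ->
  exists K, 0 < K /\
    forall i s, (i <= d)%nat -> Rabs s <= L -> sum_n (fun j => Rabs (M i j s)) d <= K.
Proof.
  intros hL.
  set (mu := fun s => sum_n (fun i => sum_n (fun j => Rabs (M i j s)) d) d).
  destruct (continuity_ab_maj mu (- L) L) as [m [hm _]]; [lra | |].
  - intros c _; apply continuity_pt_filterlim.
    apply (continuous_sum_n (fun i s => _)); intros i hi.
    apply (continuous_sum_n (fun j s => _)); intros j hj.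
    apply continuous_comp; [auto | apply continuous_Rabs].
  - exists (Rabs (mu m) + 1); split; [assert (h := Rabs_pos (mu m)); lra |].
    intros i s hi hs; apply Rabs_le_between in hs.
    eapply Rle_trans; [| eapply Rle_trans; [apply (hm s hs) |]].
    + apply (sum_n_nonneg_term (fun i => sum_n (fun j => Rabs (M i j s)) d)); [| exact hi].
      intros k; clear; induction d as [|e IH]; [rewrite sum_O; apply Rabs_pos |].
      rewrite sum_Sn; apply Rplus_le_le_0_compat; [exact IH | apply Rabs_pos].
    + assert (h := Rle_abs (mu m)); lra.
Qed.

Lemma picard_term_geometric (L : R) : 0 < L ->
  exists C, forall n i t, (i <= d)%nat -> Rabs t <= L ->
    Rabs (picard_term M d v n i t) <= C * (1 / 2) ^ n.
Proof.
  intros hL.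
  destruct (row_sums_locally_bounded L hL) as [K [hK hrow]].
  set (C := sum_n (fun i => Rabs (v i)) d).
  assert (hC : forall i, (i <= d)%nat -> Rabs (v i) <= C).
  { intros i hi; apply (sum_n_nonneg_term (fun i => Rabs (v i))); 
      [intros j; apply Rabs_pos | exact hi]. }
  exists (C * exp (2 * K * L)); intros n i t hi ht.
  eapply Rle_trans; [apply (picard_term_bound K C L); auto |].
  replace (C * exp (2 * K * L) * (1 / 2) ^ n)
    with (C * (1 / 2) ^ n * exp (2 * K * L)) by ring.
  apply Rmult_le_compat_l.
  - apply Rmult_le_pos; [| apply pow_le; lra].
    eapply Rle_trans; [apply Rabs_pos | apply (hC 0%nat); lia].
  - apply exp_monotone; apply Rmult_le_compat_l; lra.
Qed.

(** The Picard series and its termwise derivative converge uniformly on bounded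
    intervals, so the solution is global. *)
Lemma linear_ode_exists :
  exists F : nat -> R -> R,
    (forall i, (i <= d)%nat -> F i 0 = v i) /\
    (forall i t, (i <= d)%nat ->
       is_derive (F i) t (sum_n (fun j => M i j t * F j t) d)).
Proof.
  set (T := picard_term M d v).
  set (F := fun i t => Series (fun n => T n i t)).
  exists F; split.
  - intros i hi; unfold F.
    destruct (picard_term_geometric 1 Rlt_0_1) as [C hC].
    rewrite Series_incr_1.
    + rewrite (Series_ext _ (fun _ => 0 * 0)).
      * rewrite Series_scal_l, Rmult_0_l; unfold T; simpl; ring.
      * intros n; unfold T; simpl; rewrite Rmult_0_l.
        apply (RInt_point (V := R_CompleteNormedModule)).
    + apply geometric_ex_series with C; intros n; apply hC; [exact hi |].
      rewrite Rabs_R0; lra.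
  - intros i t hi.
    assert (hL : 0 < Rabs t + 1) by (assert (h := Rabs_pos t); lra).
    set (L := mkposreal _ hL).
    destruct (picard_term_geometric L hL) as [C hC].
    destruct (row_sums_locally_bounded L hL) as [K [hK hrow]].
    apply is_derive_Reals.
    (* The partial sums are shifted by one, because the derivative of the sum up
       to [n + 1] is [M] applied to the sum up to [n]. *)
    apply (CVU_derivable
      (fun n s => sum_n (fun k => T k i s) (S n))
      (fun n s => sum_n (fun j => M i j s * sum_n (fun k => T k j s) n) d)
      (F i) (fun s => sum_n (fun j => M i j s * F j s) d) 0 L).
    + intros eps heps.
      assert (hlim := is_lim_seq_geom (1 / 2) ltac:(rewrite Rabs_pos_eq; lra)).
      apply (is_lim_seq_scal_l _ (K * C)) in hlim; simpl in hlim.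
      rewrite Rmult_0_r in hlim.
      apply is_lim_seq_spec in hlim; destruct (hlim (mkposreal eps heps)) as [N hN].
      exists N; intros n s hn hs; specialize (hN n hn); simpl in hN.
      unfold Boule in hs; rewrite Rminus_0_r in hs.
      eapply Rle_lt_trans; [| eapply Rle_lt_trans; [apply Rle_abs | rewrite Rminus_0_r in hN; exact hN]].
      replace (_ - _) with
        (sum_n (fun j => M i j s * (F j s - sum_n (fun k => T k j s) n)) d).
      * eapply Rle_trans.
        { apply (sum_n_mult_le _ (fun j => F j s - sum_n (fun k => T k j s) n)).
          intros j hj; apply (geometric_tail (fun k => T k j s) C).
          intros k; apply hC; [exact hj | lra]. }
        rewrite Rmult_assoc; apply Rmult_le_compat_r; [| apply hrow; [exact hi | lra]].
        eapply Rle_trans; [apply Rabs_pos | apply (hC n i s hi); lra].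
      * rewrite <- sum_n_Rminus; apply sum_n_ext; intros j; simpl; ring.
    + intros s hs; unfold Boule in hs; rewrite Rminus_0_r in hs.
      apply is_lim_seq_Reals, (is_lim_seq_incr_1 (fun n => sum_n (fun k => T k i s) n)).
      apply (Series_correct (fun k => T k i s)), geometric_ex_series with C.
      intros n; apply hC; [exact hi | lra].
    + intros n s _; apply is_derive_Reals.
      induction n as [|n IH].
      * apply is_derive_ext with (fun s => v i + T 1%nat i s).
        { intros r; rewrite sum_Sn, sum_O; reflexivity. }
        rewrite (sum_n_ext _ (fun j => M i j s * T 0%nat j s))
          by (intros j; rewrite sum_O; reflexivity).
        rewrite <- (Rplus_0_l (sum_n _ _)).
        apply (is_derive_plus (fun _ => v i)); [apply is_derive_Reals, derivable_pt_lim_const |].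
        now apply picard_term_derive.
      * apply is_derive_ext with
          (fun s => sum_n (fun k => T k i s) (S n) + T (S (S n)) i s).
        { intros r; rewrite (sum_Sn _ (S n)); reflexivity. }
        rewrite (sum_n_ext _ (fun j => plus (M i j s * sum_n (fun k => T k j s) n)
                                            (M i j s * T (S n) j s))).
        2:{ intros j; rewrite sum_Sn; unfold plus; simpl; ring. }
        rewrite (sum_n_plus (G := R_AbelianMonoid)).
        apply (is_derive_plus (fun s => sum_n (fun k => T k i s) (S n))); [exact IH |].
        now apply picard_term_derive.
    + unfold Boule, L; simpl; rewrite Rminus_0_r; lra.
Qed.
End Picard.

(** * Rotation equations and a Gronwall estimate *)

Lemma is_derive_eq (f : R -> R) (x l l' : R) :
  is_derive f x l -> l = l' -> is_derive f x l'.
Proof. now intros h <-. Qed.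

Lemma is_derive_Rplus (f g : R -> R) (x a b : R) :
  is_derive f x a -> is_derive g x b -> is_derive (fun t => f t + g t) x (a + b).
Proof. apply (is_derive_plus (V := R_NormedModule)). Qed.

Lemma is_derive_Rminus (f g : R -> R) (x a b : R) :
  is_derive f x a -> is_derive g x b -> is_derive (fun t => f t - g t) x (a - b).
Proof. apply (is_derive_minus (V := R_NormedModule)). Qed.

Lemma is_derive_Ropp (f : R -> R) (x a : R) :
  is_derive f x a -> is_derive (fun t => - f t) x (- a).
Proof. apply (is_derive_opp (V := R_NormedModule)). Qed.

Lemma is_derive_Rmult (f g : R -> R) (x a b : R) :
  is_derive f x a -> is_derive g x b ->
  is_derive (fun t => f t * g t) x (a * g x + f x * b).
Proof.
  intros hf hg; apply is_derive_Reals in hf, hg; apply is_derive_Reals.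
  now apply (derivable_pt_lim_mult f g).
Qed.

Lemma is_derive_Rexp (f : R -> R) (x a : R) :
  is_derive f x a -> is_derive (fun t => exp (f t)) x (a * exp (f x)).
Proof.
  intros hf; apply (is_derive_comp exp f x (exp (f x)) a); [| exact hf].
  apply is_derive_Reals, derivable_pt_lim_exp.
Qed.

Lemma is_derive_Rdiv (f g : R -> R) (x a b : R) :
  is_derive f x a -> is_derive g x b -> g x <> 0 ->
  is_derive (fun t => f t / g t) x ((a * g x - f x * b) / g x ^ 2).
Proof.
  intros hf hg h0; apply is_derive_eq with (1 := is_derive_div _ _ _ _ _ hf hg h0); reflexivity.
Qed.

Lemma is_derive_Rconst (c x : R) : is_derive (fun _ : R => c) x 0.
Proof. apply (is_derive_const (V := R_NormedModule)). Qed.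

Lemma is_derive_Rid (x : R) : is_derive (fun t : R => t) x 1.
Proof. apply (is_derive_id (K := R_AbsRing)). Qed.

(** The hypotheses are tried with [is_derive] opaque, since unification would
    otherwise unfold it down to filters. *)
Ltac derive_step :=
  lazymatch goal with
  | |- is_derive (fun _ => ?c) _ _ => apply (is_derive_Rconst c)
  | |- is_derive (fun t => t) _ _ => apply is_derive_Rid
  | |- is_derive (fun t => @?f t + @?g t) _ _ => apply (is_derive_Rplus f g)
  | |- is_derive (fun t => @?f t - @?g t) _ _ => apply (is_derive_Rminus f g)
  | |- is_derive (fun t => - @?f t) _ _ => apply (is_derive_Ropp f)
  | |- is_derive (fun t => @?f t * @?g t) _ _ => apply (is_derive_Rmult f g)
  | |- is_derive (fun t => @?f t / @?g t) _ _ => apply (is_derive_Rdiv f g)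
  | |- is_derive (fun t => exp (@?f t)) _ _ => apply (is_derive_Rexp f)
  | |- is_derive _ _ _ =>
      match goal with H : context [is_derive _ _ _] |- _ =>
        with_strategy opaque [is_derive] apply H end
  end.

(** Proves a real equation stated in an algebraic structure whose carrier is only
    convertible to [R], where [ring] finds no ring structure. *)
Ltac ring_R :=
  match goal with |- @eq _ ?a ?b => let H := fresh in
    assert (H : @eq R a b); [ring | exact H] end.

(** Differentiates a formula built from functions with derivatives known from the
    context.  The remaining goals are the nonvanishing of denominators and the
    comparison of the result with the expected derivative. *)
Ltac derive_by_rules :=
  eapply is_derive_eq; [repeat derive_step |]; cbv beta.

Lemma derivative_zero_const (f : R -> R) :
  (forall t, is_derive f t 0) -> forall t, f t = f 0.
Proof.
  intros h t.
  assert (e := mean_value_bound f (fun _ => 0) 0 t 0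
    (fun s _ => h s) ltac:(intros; cbv beta; rewrite Rabs_R0; lra)).
  assert (p := Rabs_pos (f t - f 0)).
  rewrite Rmult_0_l in e; apply Rminus_diag_uniq.
  destruct (Req_dec (f t - f 0) 0) as [| ne]; [assumption |].
  apply Rabs_pos_lt in ne; lra.
Qed.

(** The equation of a vector turned by an infinitesimal rotation.  The frame
    satisfies it along vertical lines as [(a, b, c)] and along the horizontal
    axis with the last two components exchanged. *)
Lemma rotation_ode_exists (al be : R -> R) (a0 b0 c0 : R) :
  (forall t, continuous al t) -> (forall t, continuous be t) ->
  exists a b c : R -> R,
    (a 0 = a0 /\ b 0 = b0 /\ c 0 = c0) /\
    (forall t, is_derive a t (al t * c t)) /\
    (forall t, is_derive b t (be t * c t)) /\
    (forall t, is_derive c t (- (al t * a t) - be t * b t)).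
Proof.
  intros hal hbe.
  set (M := fun i j : nat => match i, j with
    | 0%nat, 2%nat => al | 1%nat, 2%nat => be
    | 2%nat, 0%nat => fun t => - al t | 2%nat, 1%nat => fun t => - be t
    | _, _ => fun _ => 0 end).
  destruct (linear_ode_exists M 2
    (fun i => match i with 0%nat => a0 | 1%nat => b0 | _ => c0 end)) as [F [F0 hF]].
  { intros i j t hi hj.
    destruct i as [|[|[|i]]]; destruct j as [|[|[|j]]]; simpl;
      auto using continuous_const;
      now apply (continuous_opp (V := R_NormedModule)). }
  exists (F 0%nat), (F 1%nat), (F 2%nat).
  split; [split; [| split]; apply F0; lia |].
  split; [| split]; intros t;
    (eapply is_derive_eq; [apply hF; lia |]);
    rewrite !sum_Sn, sum_O; unfold plus; simpl; ring.
Qed.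

Lemma rotation_ode_norm (al be a b c : R -> R) :
  (forall t, is_derive a t (al t * c t)) ->
  (forall t, is_derive b t (be t * c t)) ->
  (forall t, is_derive c t (- (al t * a t) - be t * b t)) ->
  forall t, a t ^ 2 + b t ^ 2 + c t ^ 2 = a 0 ^ 2 + b 0 ^ 2 + c 0 ^ 2.
Proof.
  intros ha hb hc t.
  apply (derivative_zero_const (fun t => a t ^ 2 + b t ^ 2 + c t ^ 2)); clear t; intros t.
  apply is_derive_ext with (fun t => a t * a t + b t * b t + c t * c t); [intros s; ring_R |].
  derive_by_rules; ring.
Qed.

(** [exp (- |s|) * (E s + r)] is nonincreasing away from 0. *)
Lemma gronwall_unit (E dE : R -> R) (r t : R) :
  (forall s, is_derive E s (dE s)) ->
  (forall s, Rmin 0 t <= s <= Rmax 0 t -> Rabs (dE s) <= E s + r) -> 0 <= r ->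
  E t <= exp (Rabs t) * (E 0 + r).
Proof.
  intros hE hb hr.
  assert (main : forall sg y, (sg = 1 \/ sg = -1) -> 0 <= y -> t = sg * y ->
    exp (- 0) * - (E (sg * 0) + r) <= exp (- y) * - (E (sg * y) + r)).
  { intros sg y hsg hy et.
    apply (nonneg_derivative_le (fun s => exp (- s) * - (E (sg * s) + r))
      (fun s => exp (- s) * (E (sg * s) + r - sg * dE (sg * s)))); [exact hy | |].
    - intros s _.
      assert (hc : is_derive (fun s => E (sg * s)) s (sg * dE (sg * s))).
      { apply (is_derive_comp E (fun s => sg * s)); [apply hE |].
        derive_by_rules; ring. }
      derive_by_rules; ring.
    - intros s hs; apply Rmult_le_pos; [left; apply exp_pos |].
      assert (h : Rabs (dE (sg * s)) <= E (sg * s) + r).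
      { apply hb; subst t; destruct hsg as [-> | ->];
          unfold Rmin, Rmax; destruct Rle_dec; lra. }
      apply Rabs_le_between in h; destruct hsg as [-> | ->]; lra. }
  destruct (sign_times_abs t) as [sg [hsg et]].
  specialize (main sg (Rabs t) hsg (Rabs_pos t) et).
  rewrite <- et, Ropp_0, exp_0, Rmult_0_r, Rmult_1_l in main.
  assert (h1 : exp (- Rabs t) * exp (Rabs t) = 1)
    by (rewrite <- exp_plus, Rplus_opp_l; apply exp_0).
  assert (h2 := exp_pos (Rabs t)).
  assert (h3 : exp (Rabs t) * (exp (- Rabs t) * (E t + r)) = E t + r)
    by (rewrite <- Rmult_assoc, (Rmult_comm (exp (Rabs t))), h1; ring).
  assert (exp (Rabs t) * (exp (- Rabs t) * (E t + r)) <= exp (Rabs t) * (E 0 + r)).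
  { apply Rmult_le_compat_l; lra. }
  lra.
Qed.

(** * Uniform first-order expansions *)

Lemma first_order_of_is_derive (f : R -> R) (x l : R) :
  is_derive f x l -> forall eps, 0 < eps -> exists delta, 0 < delta /\
    forall h, Rabs h < delta -> Rabs (f (x + h) - f x - h * l) <= eps * Rabs h.
Proof.
  intros hd eps heps; apply is_derive_Reals in hd.
  destruct (hd eps heps) as [delta hdelta].
  exists delta; split; [apply cond_pos |]; intros h hh.
  destruct (Req_dec h 0) as [-> | hne].
  - rewrite Rplus_0_r, Rabs_R0, Rmult_0_l, Rmult_0_r.
    replace (f x - f x - 0) with 0 by ring; rewrite Rabs_R0; lra.
  - specialize (hdelta h hne hh).
    replace (f (x + h) - f x - h * l) with (((f (x + h) - f x) / h - l) * h) by (field; exact hne).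
    rewrite Rabs_mult; apply Rmult_le_compat_r; [apply Rabs_pos | lra].
Qed.

Lemma is_derive_of_first_order (f : R -> R) (x l : R) :
  (forall eps, 0 < eps -> exists delta, 0 < delta /\
    forall h, Rabs h < delta -> Rabs (f (x + h) - f x - h * l) <= eps * Rabs h) ->
  is_derive f x l.
Proof.
  intros hf; apply is_derive_Reals; intros eps heps.
  destruct (hf (eps / 2) ltac:(lra)) as [delta [hd hdelta]].
  exists (mkposreal delta hd); intros h hne hh; specialize (hdelta h hh).
  apply Rle_lt_trans with (eps / 2); [| lra].
  replace ((f (x + h) - f x) / h - l) with ((f (x + h) - f x - h * l) / h) by (field; exact hne).
  unfold Rdiv; rewrite Rabs_mult, Rabs_inv.
  apply Rmult_le_reg_r with (Rabs h); [now apply Rabs_pos_lt |].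
  rewrite Rmult_assoc, Rinv_l, Rmult_1_r by (now apply Rabs_no_R0); exact hdelta.
Qed.

Lemma uniform_continuity_segment (f : R -> R -> R) (x y : R) :
  (forall x y, continuity_2d_pt f x y) ->
  forall eps, 0 < eps -> exists delta, 0 < delta /\
    forall h s, Rabs h < delta -> Rmin 0 y <= s <= Rmax 0 y ->
    Rabs (f (x + h) s - f x s) < eps.
Proof.
  intros hf eps heps.
  destruct (uniform_continuity_2d f (x - 1) (x + 1) (Rmin 0 y) (Rmax 0 y)
    (fun x y _ _ => hf x y) (mkposreal eps heps)) as [delta hdelta].
  exists (Rmin delta 1); split; [apply Rmin_pos; [apply cond_pos | lra] |].
  intros h s hh hs.
  assert (h1 := Rlt_le_trans _ _ _ hh (Rmin_l _ _)).
  assert (h2 := Rlt_le_trans _ _ _ hh (Rmin_r _ _)); apply Rabs_lt_between in h2.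
  apply hdelta; try assumption; try lra.
  - now replace (x + h - x) with h by ring.
  - rewrite Rminus_diag, Rabs_R0; apply cond_pos.
Qed.

(** The remainder is uniform in [s] because it is the integral over a short
    interval of the oscillation of [fx], and [fx] is uniformly continuous near
    a vertical segment. *)
Lemma uniform_first_order_segment (f fx : R -> R -> R) (x y : R) :
  (forall x y, is_derive (fun z => f z y) x (fx x y)) ->
  (forall x y, continuity_2d_pt fx x y) ->
  forall eps, 0 < eps -> exists delta, 0 < delta /\
    forall h s, Rabs h < delta -> Rmin 0 y <= s <= Rmax 0 y ->
    Rabs (f (x + h) s - f x s - h * fx x s) <= eps * Rabs h.
Proof.
  intros hd hc eps heps.
  destruct (uniform_continuity_segment fx x y hc eps heps) as [delta [hp hdelta]].
  exists delta; split; [exact hp |]; intros h s hh hs.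
  assert (b := mean_value_bound (fun z => f z s - z * fx x s)
    (fun z => fx z s - fx x s) x (x + h) eps).
  replace (x + h - x) with h in b by ring.
  replace (f (x + h) s - f x s - h * fx x s)
    with (f (x + h) s - (x + h) * fx x s - (f x s - x * fx x s)) by ring.
  apply b.
  - intros t _; derive_by_rules; ring.
  - intros t ht; left; replace t with (x + (t - x)) at 1 by ring.
    apply hdelta; [| exact hs].
    apply Rle_lt_trans with (2 := hh).
    unfold Rmin, Rmax in ht; destruct Rle_dec;
      unfold Rabs; destruct Rcase_abs; destruct Rcase_abs; lra.
Qed.

Lemma continuity_2d_section_x (f : R -> R -> R) (x y : R) :
  continuity_2d_pt f x y -> continuous (fun z => f z y) x.
Proof.
  intros hf; apply continuity_pt_filterlim; intros eps heps.
  destruct (hf (mkposreal eps heps)) as [delta hd].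
  exists delta; split; [apply cond_pos |]; intros z [_ hz].
  apply hd; [exact hz | rewrite Rminus_diag, Rabs_R0; apply cond_pos].
Qed.

Lemma continuity_2d_section_y (f : R -> R -> R) (x y : R) :
  continuity_2d_pt f x y -> continuous (fun z => f x z) y.
Proof.
  intros hf; apply continuity_pt_filterlim; intros eps heps.
  destruct (hf (mkposreal eps heps)) as [delta hd].
  exists delta; split; [apply cond_pos |]; intros z [_ hz].
  apply hd; [rewrite Rminus_diag, Rabs_R0; apply cond_pos | exact hz].
Qed.

Lemma bounded_on_segment (f : R -> R -> R) (x y : R) :
  (forall x y, continuity_2d_pt f x y) ->
  exists K, 0 < K /\ forall s, Rmin 0 y <= s <= Rmax 0 y -> Rabs (f x s) <= K.
Proof.
  intros hf.
  destruct (continuity_ab_maj (fun s => Rabs (f x s)) (Rmin 0 y) (Rmax 0 y)) as [m [hm _]].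
  - apply Rminmax.
  - intros s _ ; apply continuity_pt_filterlim.
    apply (continuous_comp (fun s => f x s) Rabs); [| apply continuous_Rabs].
    now apply continuity_2d_section_y.
  - exists (Rabs (f x m) + 1); split; [assert (h := Rabs_pos (f x m)); lra |].
    intros s hs; specialize (hm s hs); simpl in hm; lra.
Qed.

(** * Integrability of the frame equations *)

Lemma norm_one_components (p q r : R) :
  p ^ 2 + q ^ 2 + r ^ 2 = 1 -> Rabs p <= 1 /\ Rabs q <= 1 /\ Rabs r <= 1.
Proof.
  intros h; assert (hp := pow2_ge_0 p); assert (hq := pow2_ge_0 q); assert (hr := pow2_ge_0 r).
  split; [| split]; apply Rabs_le; nra.
Qed.

Lemma Rabs_mult_le (p q P Q : R) :
  Rabs p <= P -> Rabs q <= Q -> Rabs (p * q) <= P * Q.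
Proof.
  intros hp hq; rewrite Rabs_mult; apply Rmult_le_compat; auto using Rabs_pos.
Qed.

Lemma Rabs_plus_le (p q P Q : R) :
  Rabs p <= P -> Rabs q <= Q -> Rabs (p + q) <= P + Q.
Proof.
  intros hp hq; eapply Rle_trans; [apply Rabs_triang | lra].
Qed.

Section Frame.
Variables u ux uy uxx uyy : R -> R -> R.
Hypothesis u_x : forall x y, is_derive (fun z => u z y) x (ux x y).
Hypothesis u_y : forall x y, is_derive (fun z => u x z) y (uy x y).
Hypothesis u_xx : forall x y, is_derive (fun z => ux z y) x (uxx x y).
Hypothesis u_yy : forall x y, is_derive (fun z => uy x z) y (uyy x y).
Hypothesis cu : forall x y, continuity_2d_pt u x y.
Hypothesis cux : forall x y, continuity_2d_pt ux x y.
Hypothesis cuy : forall x y, continuity_2d_pt uy x y.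
Hypothesis cuxx : forall x y, continuity_2d_pt uxx x y.
Hypothesis liouville : forall x y, uxx x y + uyy x y + exp (u x y) * exp (u x y) = 0.

Lemma continuity_2d_exp_u x y : continuity_2d_pt (fun x y => exp (u x y)) x y.
Proof.
  apply (continuity_1d_2d_pt_comp exp u); [| apply cu].
  apply derivable_continuous_pt, derivable_pt_exp.
Qed.

Variables a b c : R -> R -> R.
Hypothesis a_y : forall x y, is_derive (fun z => a x z) y (exp (u x y) * c x y).
Hypothesis b_y : forall x y, is_derive (fun z => b x z) y (ux x y * c x y).
Hypothesis c_y : forall x y,
  is_derive (fun z => c x z) y (- (exp (u x y) * a x y) - ux x y * b x y).
Hypothesis unit : forall x y, a x y ^ 2 + b x y ^ 2 + c x y ^ 2 = 1.
Hypothesis a_x0 : forall x, is_derive (fun z => a z 0) x (exp (u x 0) * b x 0).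
Hypothesis b_x0 : forall x,
  is_derive (fun z => b z 0) x (- (uy x 0 * c x 0) - exp (u x 0) * a x 0).
Hypothesis c_x0 : forall x, is_derive (fun z => c z 0) x (uy x 0 * b x 0).

(** The frame is built on the horizontal axis and then along vertical lines.  That
    it also solves the horizontal equations off the axis is shown without
    differentiating solutions with respect to a parameter: [d1, d2, d3] below is
    the error of the first-order expansion in the direction of [x] that these
    equations predict. *)
Section Remainder.
Variables x y h eps K : R.
Hypothesis heps : 0 <= eps.
Hypothesis hK : 1 <= K.

Let d1 s := a (x + h) s - a x s - h * (exp (u x s) * b x s).
Let d2 s := b (x + h) s - b x s - h * (- (uy x s * c x s) - exp (u x s) * a x s).
Let d3 s := c (x + h) s - c x s - h * (uy x s * b x s).
Let al s := exp (u (x + h) s) - exp (u x s).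
Let be s := ux (x + h) s - ux x s.
Let r1 s := (al s - h * (ux x s * exp (u x s))) * c x s + h * (al s * (uy x s * b x s)).
Let r2 s := (be s - h * uxx x s) * c x s + h * (be s * (uy x s * b x s)).
Let r3 s := - ((al s - h * (ux x s * exp (u x s))) * a x s)
  + - ((be s - h * uxx x s) * b x s)
  + h * (be s * (exp (u x s) * a x s)) + - (h * (al s * (exp (u x s) * b x s)))
  + h * (be s * (uy x s * c x s)).

(** By the Liouville equation the error satisfies the vertical equation at
    [x + h], up to the source [(r1, r2, r3)], which is small compared with [h]. *)
Lemma remainder_derive :
  (forall s, is_derive d1 s (exp (u (x + h) s) * d3 s + r1 s)) /\
  (forall s, is_derive d2 s (ux (x + h) s * d3 s + r2 s)) /\
  (forall s, is_derive d3 s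
     (- (exp (u (x + h) s) * d1 s) - ux (x + h) s * d2 s + r3 s)).
Proof.
  split; [| split]; intros s; assert (L := liouville x s);
    assert (L' : uyy x s = - uxx x s - exp (u x s) * exp (u x s)) by lra;
    unfold d1, d2, d3, r1, r2, r3, al, be; derive_by_rules; try ring.
  all: rewrite L'; ring.
Qed.

Lemma remainder_bound s :
  Rabs (al s) <= eps -> Rabs (be s) <= eps ->
  Rabs (al s - h * (ux x s * exp (u x s))) <= eps * Rabs h ->
  Rabs (be s - h * uxx x s) <= eps * Rabs h ->
  Rabs (exp (u x s)) <= K -> Rabs (uy x s) <= K ->
  Rabs (r1 s) <= 5 * K * eps * Rabs h /\ Rabs (r2 s) <= 5 * K * eps * Rabs h /\
  Rabs (r3 s) <= 5 * K * eps * Rabs h.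
Proof.
  intros hal hbe hal' hbe' hKe hKu.
  destruct (norm_one_components _ _ _ (unit x s)) as [ha [hb hc]].
  assert (hh := Rabs_pos h).
  assert (hle : eps * Rabs h <= K * eps * Rabs h)
    by (apply Rmult_le_compat_r; [exact hh |];
        rewrite <- (Rmult_1_l eps) at 1; now apply Rmult_le_compat_r).
  assert (hle0 : 0 <= eps * Rabs h) by (now apply Rmult_le_pos).
  split; [| split]; unfold r1, r2, r3.
  - apply Rle_trans with (eps * Rabs h * 1 + Rabs h * (eps * (K * 1))); [| lra].
    apply Rabs_plus_le; repeat apply Rabs_mult_le; auto with real.
  - apply Rle_trans with (eps * Rabs h * 1 + Rabs h * (eps * (K * 1))); [| lra].
    apply Rabs_plus_le; repeat apply Rabs_mult_le; auto with real.
  - apply Rle_trans with (eps * Rabs h * 1 + eps * Rabs h * 1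
      + Rabs h * (eps * (K * 1)) + Rabs h * (eps * (K * 1)) + Rabs h * (eps * (K * 1)));
      [| lra].
    repeat apply Rabs_plus_le; rewrite ?Rabs_Ropp;
      repeat apply Rabs_mult_le; auto with real.
Qed.

(** The rotation does not change the length of the error vector, so only the
    source contributes to the growth of its square. *)
Lemma increment_bound :
  (forall s, Rmin 0 y <= s <= Rmax 0 y ->
    Rabs (al s) <= eps /\ Rabs (be s) <= eps /\
    Rabs (al s - h * (ux x s * exp (u x s))) <= eps * Rabs h /\
    Rabs (be s - h * uxx x s) <= eps * Rabs h /\
    Rabs (exp (u x s)) <= K /\ Rabs (uy x s) <= K) ->
  Rabs (d1 0) <= eps * Rabs h -> Rabs (d2 0) <= eps * Rabs h ->
  Rabs (d3 0) <= eps * Rabs h ->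
  Rabs (d1 y) <= 9 * K * exp (Rabs y) * eps * Rabs h /\
  Rabs (d2 y) <= 9 * K * exp (Rabs y) * eps * Rabs h /\
  Rabs (d3 y) <= 9 * K * exp (Rabs y) * eps * Rabs h.
Proof.
  intros hseg h1 h2 h3.
  destruct remainder_derive as [dd1 [dd2 dd3]].
  set (rho := 5 * K * eps * Rabs h).
  set (e := eps * Rabs h) in *.
  assert (he : 0 <= e) by (apply Rmult_le_pos; [exact heps | apply Rabs_pos]).
  assert (sq : forall p B, Rabs p <= B -> p * p <= B * B).
  { intros p B hp; assert (q := Rabs_pos p); change (Rsqr p <= B * B).
    rewrite Rsqr_abs; unfold Rsqr.
    apply Rmult_le_compat; assumption. }
  assert (G := gronwall_unit
    (fun s => d1 s * d1 s + d2 s * d2 s + d3 s * d3 s)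
    (fun s => 2 * (d1 s * r1 s + d2 s * r2 s + d3 s * r3 s)) (3 * (rho * rho)) y).
  cbv beta in G.
  assert (G' : d1 y * d1 y + d2 y * d2 y + d3 y * d3 y <=
    exp (Rabs y) * (d1 0 * d1 0 + d2 0 * d2 0 + d3 0 * d3 0 + 3 * (rho * rho))).
  { apply G.
    - intros s; clearbody d1 d2 d3 r1 r2 r3; derive_by_rules; ring.
    - intros s hs; destruct (hseg s hs) as [k1 [k2 [k3 [k4 [k5 k6]]]]].
      destruct (remainder_bound s k1 k2 k3 k4 k5 k6) as [q1 [q2 q3]].
      apply sq in q1, q2, q3; fold rho in q1, q2, q3.
      assert (s1 := pow2_ge_0 (d1 s - r1 s)); assert (s1' := pow2_ge_0 (d1 s + r1 s)).
      assert (s2 := pow2_ge_0 (d2 s - r2 s)); assert (s2' := pow2_ge_0 (d2 s + r2 s)).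
      assert (s3 := pow2_ge_0 (d3 s - r3 s)); assert (s3' := pow2_ge_0 (d3 s + r3 s)).
      apply Rabs_le; lra.
    - assert (q := Rle_0_sqr rho); unfold Rsqr in q; lra. }
  apply sq in h1, h2, h3.
  assert (hX : 1 <= exp (Rabs y)).
  { eapply Rle_trans; [| apply exp_ineq1_le]; assert (q := Rabs_pos y); lra. }
  set (X := exp (Rabs y)) in *.
  set (B := 9 * K * X * eps * Rabs h).
  assert (hB : B = 9 * K * X * e) by (unfold B, e; ring).
  assert (hr : rho = 5 * K * e) by (unfold rho, e; ring).
  clearbody e rho B X.
  assert (tot : d1 y * d1 y + d2 y * d2 y + d3 y * d3 y <= B * B).
  { eapply Rle_trans; [exact G' |].
    apply Rle_trans with (X * (78 * (K * K) * (e * e))).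
    - apply Rmult_le_compat_l; [lra |].
      assert (e * e <= K * K * (e * e)).
      { rewrite <- (Rmult_1_l (e * e)) at 1.
        apply Rmult_le_compat_r; [now apply Rmult_le_pos |].
        rewrite <- (Rmult_1_l 1); apply Rmult_le_compat; lra. }
      rewrite hr; lra.
    (* Here 78 = 3 + 3 * 5^2 counts the three initial errors and the three
       squared sources; it is at most 9^2. *)
    - rewrite hB; replace (9 * K * X * e * (9 * K * X * e))
        with (X * (81 * (K * K) * (e * e)) * X) by ring.
      set (Z := K * K * (e * e)).
      assert (hXZ : 0 <= X * Z) by (unfold Z; repeat apply Rmult_le_pos; lra).
      replace (X * (78 * (K * K) * (e * e))) with (78 * (X * Z)) by (unfold Z; ring).
      replace (X * (81 * (K * K) * (e * e)) * X) with (81 * (X * Z) * X) by (unfold Z; ring).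
      assert (X * Z * 1 <= X * Z * X) by (now apply Rmult_le_compat_l); lra. }
  assert (hB0 : 0 <= B).
  { rewrite hB; repeat apply Rmult_le_pos; lra. }
  assert (root : forall p, p * p <= B * B -> Rabs p <= B).
  { intros p hp; apply Rsqr_le_abs_0 in hp; rewrite (Rabs_pos_eq B) in hp; assumption. }
  assert (s1 := Rle_0_sqr (d1 y)); assert (s2 := Rle_0_sqr (d2 y));
    assert (s3 := Rle_0_sqr (d3 y)); unfold Rsqr in *.
  split; [| split]; apply root; lra.
Qed.
End Remainder.

(** At the ordinate [y] the expansion error is at most a constant times the error on
    the axis plus the source, and both are [o(h)]. *)
Lemma frame_horizontal x y :
  is_derive (fun z => a z y) x (exp (u x y) * b x y) /\
  is_derive (fun z => b z y) x (- (uy x y * c x y) - exp (u x y) * a x y) /\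
  is_derive (fun z => c z y) x (uy x y * b x y).
Proof.
  destruct (bounded_on_segment _ x y continuity_2d_exp_u) as [K1 [hK1 bK1]].
  destruct (bounded_on_segment _ x y cuy) as [K2 [hK2 bK2]].
  set (K := 1 + K1 + K2).
  set (W := 9 * K * exp (Rabs y)).
  assert (hW : 0 < W).
  { assert (q := exp_pos (Rabs y)); unfold W, K; apply Rmult_lt_0_compat; lra. }
  assert (main : forall eta, 0 < eta -> exists delta, 0 < delta /\
    forall h, Rabs h < delta ->
    Rabs (a (x + h) y - a x y - h * (exp (u x y) * b x y)) <= eta * Rabs h /\
    Rabs (b (x + h) y - b x y - h * (- (uy x y * c x y) - exp (u x y) * a x y))
      <= eta * Rabs h /\
    Rabs (c (x + h) y - c x y - h * (uy x y * b x y)) <= eta * Rabs h).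
  { intros eta heta.
    assert (heps : 0 < eta / W) by (now apply Rdiv_lt_0_compat).
    set (eps := eta / W) in *.
    destruct (uniform_continuity_segment _ x y continuity_2d_exp_u eps heps) as [e1 [p1 b1]].
    destruct (uniform_continuity_segment _ x y cux eps heps) as [e2 [p2 b2]].
    destruct (uniform_first_order_segment (fun x y => exp (u x y))
      (fun x y => ux x y * exp (u x y)) x y) with (eps := eps) as [e3 [p3 b3]].
    { intros; derive_by_rules; ring. }
    { intros; apply continuity_2d_pt_mult; [apply cux | apply continuity_2d_exp_u]. }
    { exact heps. }
    destruct (uniform_first_order_segment ux uxx x y u_xx cuxx eps heps) as [e4 [p4 b4]].
    destruct (first_order_of_is_derive _ _ _ (a_x0 x) eps heps) as [e5 [p5 b5]].
    destruct (first_order_of_is_derive _ _ _ (b_x0 x) eps heps) as [e6 [p6 b6]].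
    destruct (first_order_of_is_derive _ _ _ (c_x0 x) eps heps) as [e7 [p7 b7]].
    exists (Rmin e1 (Rmin e2 (Rmin e3 (Rmin e4 (Rmin e5 (Rmin e6 e7)))))).
    split; [repeat apply Rmin_pos; assumption |].
    intros h hh.
    repeat (apply Rmin_Rgt_l in hh; destruct hh as [? hh]).
    replace eta with (9 * K * exp (Rabs y) * eps)
      by (unfold eps; fold W; field; lra).
    apply increment_bound; try (left; exact heps); auto.
    - unfold K; lra.
    - intros s hs; repeat split.
      + left; now apply b1.
      + left; now apply b2.
      + now apply b3.
      + now apply b4.
      + specialize (bK1 s hs); unfold K; lra.
      + specialize (bK2 s hs); unfold K; lra. }
  split; [| split]; apply is_derive_of_first_order; intros eta heta;
    destruct (main eta heta) as [delta [hd hb]];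
    exists delta; (split; [exact hd |]); intros h hh;
    destruct (hb h hh) as [q1 [q2 q3]]; assumption.
Qed.
End Frame.

(** * Bounded functions with positive Laplacian on the plane *)

Lemma second_derivative_local_max (f df : R -> R) (t l delta : R) :
  0 < delta ->
  (forall s, Rabs (s - t) < delta -> is_derive f s (df s)) ->
  is_derive df t l ->
  (forall s, Rabs (s - t) < delta -> f s <= f t) -> l <= 0.
Proof.
  intros hdelta hf hdf hmax; apply Rnot_lt_le; intros hl.
  destruct (first_order_of_is_derive _ _ _ hdf (l / 2) ltac:(lra)) as [e [he hfo]].
  set (h := Rmin delta e / 2).
  assert (hm : 0 < Rmin delta e) by (now apply Rmin_pos).
  assert (hh : 0 < h) by (unfold h; lra).
  assert (h1 : h < delta) by (assert (q := Rmin_l delta e); unfold h; lra).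
  assert (h2 : h < e) by (assert (q := Rmin_r delta e); unfold h; lra).
  clearbody h.
  destruct (Rle_dec 0 (df t)) as [hs | hs].
  - destruct (MVT_cor2 f df t (t + h)) as [c [ec hc]]; [lra | |].
    { intros s q; apply is_derive_Reals, hf, Rabs_lt_between; lra. }
    assert (q1 := hmax (t + h) ltac:(apply Rabs_lt_between; lra)).
    assert (q2 := hfo (c - t) ltac:(apply Rabs_lt_between; lra)).
    replace (t + (c - t)) with c in q2 by ring.
    rewrite (Rabs_pos_eq (c - t)) in q2 by lra; apply Rabs_le_between in q2.
    assert (0 < (c - t) * l) by (apply Rmult_lt_0_compat; lra).
    assert (0 < df c * (t + h - t)) by (apply Rmult_lt_0_compat; lra); lra.
  - destruct (MVT_cor2 f df (t - h) t) as [c [ec hc]]; [lra | |].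
    { intros s q; apply is_derive_Reals, hf, Rabs_lt_between; lra. }
    assert (q1 := hmax (t - h) ltac:(apply Rabs_lt_between; lra)).
    assert (q2 := hfo (c - t) ltac:(apply Rabs_lt_between; lra)).
    replace (t + (c - t)) with c in q2 by ring.
    rewrite (Rabs_left (c - t)) in q2 by lra; apply Rabs_le_between in q2.
    assert (0 < (t - c) * l) by (apply Rmult_lt_0_compat; lra).
    assert (0 < (- df c) * (t - (t - h))) by (apply Rmult_lt_0_compat; lra); lra.
Qed.

(** The maximum over each column depends continuously on the column, by uniform
    continuity, so two one-dimensional maxima suffice. *)
Lemma maximum_on_square (f : R -> R -> R) (L : R) :
  0 <= L -> (forall x y, continuity_2d_pt f x y) ->
  exists x0 y0, -L <= x0 <= L /\ -L <= y0 <= L /\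
    forall x y, -L <= x <= L -> -L <= y <= L -> f x y <= f x0 y0.
Proof.
  intros hL hf.
  assert (hcol : forall x, exists y, -L <= y <= L /\ forall v, -L <= v <= L -> f x v <= f x y).
  { intros x; destruct (continuity_ab_maj (f x) (- L) L) as [y [hy hy']]; [lra | |].
    - intros y _; apply continuity_pt_filterlim; now apply continuity_2d_section_y.
    - now exists y. }
  destruct (functional_choice _ hcol) as [Y hY].
  destruct (continuity_ab_maj (fun x => f x (Y x)) (- L) L) as [x0 [hx0 hx0']]; [lra | |].
  - intros x hx eps heps.
    destruct (uniform_continuity_2d f (- L - 1) (L + 1) (- L) L
      (fun x y _ _ => hf x y) (mkposreal eps heps)) as [delta hd].
    exists (Rmin delta 1); split; [apply Rmin_pos; [apply cond_pos | lra] |].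
    intros z [_ hz]; simpl in *; unfold Rdist in *.
    assert (q1 := Rlt_le_trans _ _ _ hz (Rmin_l _ _)).
    assert (q2 := Rlt_le_trans _ _ _ hz (Rmin_r _ _)); apply Rabs_lt_between in q2.
    assert (near : forall v, -L <= v <= L -> Rabs (f z v - f x v) < eps).
    { intros v hv; apply hd; try assumption; try lra.
      rewrite Rminus_diag, Rabs_R0; apply cond_pos. }
    destruct (hY x) as [a1 a2]; destruct (hY z) as [b1 b2].
    assert (n1 := near _ a1); assert (n2 := near _ b1).
    apply Rabs_lt_between in n1, n2; apply Rabs_lt_between.
    specialize (a2 _ b1); specialize (b2 _ a1); lra.
  - exists x0, (Y x0); split; [exact hx0' |]; split; [apply hY |].
    intros x y hx hy; apply Rle_trans with (f x (Y x)); [now apply hY | now apply hx0].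
Qed.

Section Liouville.
Variables S Sx Sy Sxx Syy : R -> R -> R.
Hypothesis S_x : forall x y, is_derive (fun z => S z y) x (Sx x y).
Hypothesis S_y : forall x y, is_derive (fun z => S x z) y (Sy x y).
Hypothesis S_xx : forall x y, is_derive (fun z => Sx z y) x (Sxx x y).
Hypothesis S_yy : forall x y, is_derive (fun z => Sy x z) y (Syy x y).
Hypothesis cS : forall x y, continuity_2d_pt S x y.
Hypothesis subharmonic : forall x y, 0 < Sxx x y + Syy x y.

(** The logarithm of the squared radius is harmonic away from the origin, so
    subtracting a multiple of it keeps the Laplacian positive. *)
Lemma no_log_perturbed_maximum (k x y delta : R) :
  0 < delta ->
  (forall u v, Rabs (u - x) < delta -> Rabs (v - y) < delta -> 0 < u ^ 2 + v ^ 2) ->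
  (forall u v, Rabs (u - x) < delta -> Rabs (v - y) < delta ->
    S u v - k * ln (u ^ 2 + v ^ 2) <= S x y - k * ln (x ^ 2 + y ^ 2)) -> False.
Proof.
  intros hd hpos hmax.
  assert (x0 : Rabs (x - x) < delta) by (rewrite Rminus_diag, Rabs_R0; exact hd).
  assert (y0 : Rabs (y - y) < delta) by (rewrite Rminus_diag, Rabs_R0; exact hd).
  assert (p := hpos x y x0 y0).
  assert (hx : Sxx x y - k * (2 / (x ^ 2 + y ^ 2) - 4 * x ^ 2 / (x ^ 2 + y ^ 2) ^ 2) <= 0).
  { apply (second_derivative_local_max (fun z => S z y - k * ln (z ^ 2 + y ^ 2))
      (fun z => Sx z y - k * (2 * z / (z ^ 2 + y ^ 2))) x _ delta hd).
    - intros s hs; apply is_derive_Rminus; [apply S_x |].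
      specialize (hpos s y hs y0).
      auto_derive; [exact hpos | field; lra].
    - apply is_derive_Rminus; [apply S_xx |].
      auto_derive; [lra | field; lra].
    - intros s hs; now apply hmax. }
  assert (hy : Syy x y - k * (2 / (x ^ 2 + y ^ 2) - 4 * y ^ 2 / (x ^ 2 + y ^ 2) ^ 2) <= 0).
  { apply (second_derivative_local_max (fun z => S x z - k * ln (x ^ 2 + z ^ 2))
      (fun z => Sy x z - k * (2 * z / (x ^ 2 + z ^ 2))) y _ delta hd).
    - intros s hs; apply is_derive_Rminus; [apply S_y |].
      specialize (hpos x s x0 hs).
      auto_derive; [exact hpos | field; lra].
    - apply is_derive_Rminus; [apply S_yy |].
      auto_derive; [lra | field; lra].
    - intros s hs; now apply hmax. }
  assert (harm : 2 / (x ^ 2 + y ^ 2) - 4 * x ^ 2 / (x ^ 2 + y ^ 2) ^ 2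
    + (2 / (x ^ 2 + y ^ 2) - 4 * y ^ 2 / (x ^ 2 + y ^ 2) ^ 2) = 0) by (field; lra).
  assert (q := subharmonic x y).
  assert (k * (2 / (x ^ 2 + y ^ 2) - 4 * x ^ 2 / (x ^ 2 + y ^ 2) ^ 2)
    + k * (2 / (x ^ 2 + y ^ 2) - 4 * y ^ 2 / (x ^ 2 + y ^ 2) ^ 2) = 0)
    by (rewrite <- Rmult_plus_distr_l, harm; ring).
  lra.
Qed.

Lemma no_global_maximum x y : (forall u v, S u v <= S x y) -> False.
Proof.
  intros hmax.
  assert (hx : Sxx x y <= 0).
  { apply (second_derivative_local_max (fun z => S z y) (fun z => Sx z y) x _ 1); auto; lra. }
  assert (hy : Syy x y <= 0).
  { apply (second_derivative_local_max (fun z => S x z) (fun z => Sy x z) y _ 1); auto; lra. }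
  assert (q := subharmonic x y); lra.
Qed.

(* Truncating the logarithm keeps the perturbation continuous at the origin; its
   lack of smoothness on the unit circle is harmless, since it only matters
   outside the closed disc. *)
Let ell x y := ln (Rmax 1 (x ^ 2 + y ^ 2)).

Lemma continuity_2d_ell x y : continuity_2d_pt ell x y.
Proof.
  apply (continuity_1d_2d_pt_comp (fun z => ln (Rmax 1 z)) (fun x y => x ^ 2 + y ^ 2)).
  - apply (continuity_pt_comp (Rmax 1) ln).
    + intros eps heps; exists eps; split; [exact heps |]; intros z [_ hz].
      apply Rle_lt_trans with (2 := hz); simpl; unfold Rdist, Rmax.
      repeat destruct Rle_dec; unfold Rabs; repeat destruct Rcase_abs; lra.
    + apply derivable_continuous_pt; eexists; apply derivable_pt_lim_ln.
      apply Rlt_le_trans with 1; [lra | apply Rmax_l].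
  - apply continuity_2d_pt_ext with (fun x y => x * x + y * y); [intros; ring |].
    apply continuity_2d_pt_plus; apply continuity_2d_pt_mult;
      apply continuity_2d_pt_id1 || apply continuity_2d_pt_id2.
Qed.

Lemma ell_nonneg x y : 0 <= ell x y.
Proof.
  unfold ell; rewrite <- ln_1; apply Rcomplements.ln_le; [lra | apply Rmax_l].
Qed.

Lemma ell_unit x y : x ^ 2 + y ^ 2 <= 1 -> ell x y = 0.
Proof. intros h; unfold ell; rewrite Rmax_left by exact h; apply ln_1. Qed.

(** The perturbed function tends to minus infinity, so it has a maximum; this is
    not outside the closed unit disc, where the perturbation is harmonic. *)
Lemma max_log_perturbed_in_disc (k C : R) :
  0 < k -> (forall x y, S x y <= C) ->
  exists x0 y0, -1 <= x0 <= 1 /\ -1 <= y0 <= 1 /\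
    forall x y, S x y - k * ell x y <= S x0 y0.
Proof.
  intros hk hC.
  (* Outside the disc of radius [L] the perturbation exceeds [C - S 0 0], so the
     values there are below the value at the origin. *)
  set (L := 1 + exp ((C - S 0 0) / k)).
  assert (hL : 1 <= L) by (unfold L; assert (q := exp_pos ((C - S 0 0) / k)); lra).
  destruct (maximum_on_square (fun x y => S x y - k * ell x y) L) as [x0 [y0 [hx0 [hy0 hm]]]].
  { lra. }
  { intros x y; apply continuity_2d_pt_minus; [apply cS |].
    apply continuity_2d_pt_mult; [apply continuity_2d_pt_const | apply continuity_2d_ell]. }
  assert (hm0 : S 0 0 <= S x0 y0 - k * ell x0 y0).
  { specialize (hm 0 0 ltac:(lra) ltac:(lra)); rewrite (ell_unit 0 0) in hm by lra; lra. }
  assert (hglob : forall x y, S x y - k * ell x y <= S x0 y0 - k * ell x0 y0).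
  { intros x y.
    destruct (Rle_dec (x ^ 2 + y ^ 2) (L ^ 2)) as [hin | hout].
    - assert (qx := pow2_ge_0 x); assert (qy := pow2_ge_0 y).
      apply hm; apply Rabs_le_between;
        rewrite <- (Rabs_pos_eq L) by lra; apply Rsqr_le_abs_0; unfold Rsqr; lra.
    - apply Rle_trans with (2 := hm0).
      assert (q : (C - S 0 0) / k <= ell x y).
      { unfold ell; rewrite <- (ln_exp ((C - S 0 0) / k)).
        apply Rcomplements.ln_le; [apply exp_pos |].
        apply Rle_trans with (2 := Rmax_r _ _).
        assert (p := exp_pos ((C - S 0 0) / k)).
        set (X := exp ((C - S 0 0) / k)) in *.
        assert (0 <= X * X) by (apply Rmult_le_pos; lra).
        unfold L in hout; simpl in *; lra. }
      apply (Rmult_le_compat_l k) in q; [| lra].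
      replace (k * ((C - S 0 0) / k)) with (C - S 0 0) in q by (field; lra).
      specialize (hC x y); lra. }
  destruct (Rle_dec (x0 ^ 2 + y0 ^ 2) 1) as [hin | hout].
  - exists x0, y0.
    assert (qx := pow2_ge_0 x0); assert (qy := pow2_ge_0 y0).
    split; [| split].
    + apply Rabs_le_between; rewrite <- (Rabs_pos_eq 1) by lra.
      apply Rsqr_le_abs_0; unfold Rsqr; lra.
    + apply Rabs_le_between; rewrite <- (Rabs_pos_eq 1) by lra.
      apply Rsqr_le_abs_0; unfold Rsqr; lra.
    + intros x y; specialize (hglob x y); rewrite (ell_unit x0 y0 hin) in hglob; lra.
  - exfalso.
    assert (hc : continuity_2d_pt (fun x y => x * x + y * y) x0 y0).
    { apply continuity_2d_pt_plus; apply continuity_2d_pt_mult;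
        apply continuity_2d_pt_id1 || apply continuity_2d_pt_id2. }
    assert (he : 0 < x0 ^ 2 + y0 ^ 2 - 1) by lra.
    destruct (hc (mkposreal _ he)) as [delta hd]; simpl in hd.
    assert (hout' : forall u v, Rabs (u - x0) < delta -> Rabs (v - y0) < delta ->
      1 < u ^ 2 + v ^ 2).
    { intros u v hu hv; specialize (hd u v hu hv); apply Rabs_lt_between in hd; lra. }
    apply (no_log_perturbed_maximum k x0 y0 delta (cond_pos delta)).
    + intros u v hu hv; specialize (hout' u v hu hv); lra.
    + intros u v hu hv; specialize (hglob u v); unfold ell in hglob.
      rewrite (Rmax_right 1 (u ^ 2 + v ^ 2)), (Rmax_right 1 (x0 ^ 2 + y0 ^ 2)) in hglob;
        [exact hglob | lra | left; now apply hout'].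
Qed.

(** Letting the logarithmic perturbation tend to 0, a bounded function would be at
    most its maximum over the square around the origin.  That would be a global
    maximum, where the Laplacian cannot be positive. *)
Lemma subharmonic_unbounded (C : R) : (forall x y, S x y <= C) -> False.
Proof.
  intros hC.
  destruct (maximum_on_square S 1) as [x1 [y1 [_ [_ hm]]]]; [lra | exact cS |].
  apply (no_global_maximum x1 y1); intros x y.
  apply Rnot_lt_le; intros hlt.
  assert (hell := ell_nonneg x y).
  (* With this [k] the perturbation at [(x, y)] is less than half the excess. *)
  set (k := (S x y - S x1 y1) / (2 * (1 + ell x y))).
  assert (hk : 0 < k) by (apply Rdiv_lt_0_compat; lra).
  destruct (max_log_perturbed_in_disc k C hk hC) as [x0 [y0 [hx [hy h]]]].
  specialize (h x y); specialize (hm x0 y0 hx hy).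
  assert (e : k * (2 * (1 + ell x y)) = S x y - S x1 y1) by (unfold k; field; lra).
  assert (0 <= k * ell x y) by (apply Rmult_le_pos; lra); lra.
Qed.
End Liouville.

(** * Developing the plane on the sphere *)

(** The part of the smoothness of [u] that the proof uses, with the partial
    derivatives named; [exp u * exp u] is the conformal factor. *)
Record liouville_potential (u ux uy uxx uyy : R -> R -> R) : Prop := {
  lp_x : forall x y, is_derive (fun z => u z y) x (ux x y);
  lp_y : forall x y, is_derive (fun z => u x z) y (uy x y);
  lp_xx : forall x y, is_derive (fun z => ux z y) x (uxx x y);
  lp_yy : forall x y, is_derive (fun z => uy x z) y (uyy x y);
  lp_c : forall x y, continuity_2d_pt u x y;
  lp_cx : forall x y, continuity_2d_pt ux x y;
  lp_cy : forall x y, continuity_2d_pt uy x y;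
  lp_cxx : forall x y, continuity_2d_pt uxx x y;
  lp_eq : forall x y, uxx x y + uyy x y + exp (u x y) * exp (u x y) = 0
}.

(** The Darboux equations of the developing map, paired with a fixed unit vector
    of R^3: [a] is the component of that vector along the position on the sphere,
    [b] and [c] its components along the images of the two coordinate
    directions normalized by [exp (- u)]. *)
Record sphere_frame (u ux uy a b c : R -> R -> R) : Prop := {
  sf_ax : forall x y, is_derive (fun z => a z y) x (exp (u x y) * b x y);
  sf_bx : forall x y,
    is_derive (fun z => b z y) x (- (uy x y * c x y) - exp (u x y) * a x y);
  sf_cx : forall x y, is_derive (fun z => c z y) x (uy x y * b x y);
  sf_ay : forall x y, is_derive (fun z => a x z) y (exp (u x y) * c x y);
  sf_by : forall x y, is_derive (fun z => b x z) y (ux x y * c x y);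
  sf_cy : forall x y,
    is_derive (fun z => c x z) y (- (exp (u x y) * a x y) - ux x y * b x y);
  sf_unit : forall x y, a x y ^ 2 + b x y ^ 2 + c x y ^ 2 = 1
}.

Lemma sphere_frame_exists (u ux uy uxx uyy : R -> R -> R) :
  liouville_potential u ux uy uxx uyy ->
  exists a b c, sphere_frame u ux uy a b c /\ a 0 0 = 1.
Proof.
  intros [u_x u_y u_xx u_yy cu cux cuy cuxx pde].
  destruct (rotation_ode_exists (fun x => exp (u x 0)) (fun x => uy x 0) 1 0 0)
    as [A [C [B [[A0 [C0 B0]] [dA [dC dB]]]]]].
  { intros x; apply (continuity_2d_section_x (fun x y => exp (u x y))).
    now apply continuity_2d_exp_u. }
  { intros x; now apply continuity_2d_section_x. }
  destruct (functional_choice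
    (fun x (F : (R -> R) * (R -> R) * (R -> R)) =>
       let a := fst (fst F) in let b := snd (fst F) in let c := snd F in
       (a 0 = A x /\ b 0 = B x /\ c 0 = C x) /\
       (forall y, is_derive a y (exp (u x y) * c y)) /\
       (forall y, is_derive b y (ux x y * c y)) /\
       (forall y, is_derive c y (- (exp (u x y) * a y) - ux x y * b y)))) as [F hF].
  { intros x.
    destruct (rotation_ode_exists (fun y => exp (u x y)) (ux x) (A x) (B x) (C x))
      as [a [b [c h]]].
    - intros y; apply (continuity_2d_section_y (fun x y => exp (u x y))).
      now apply continuity_2d_exp_u.
    - intros y; now apply continuity_2d_section_y.
    - exists (a, b, c); exact h. }
  set (a := fun x => fst (fst (F x))).
  set (b := fun x => snd (fst (F x))).
  set (c := fun x => snd (F x)).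
  assert (a0 : forall x, a x 0 = A x) by (intros x; apply (hF x)).
  assert (b0 : forall x, b x 0 = B x) by (intros x; apply (hF x)).
  assert (c0 : forall x, c x 0 = C x) by (intros x; apply (hF x)).
  assert (day : forall x y, is_derive (fun z => a x z) y (exp (u x y) * c x y))
    by (intros x; apply (hF x)).
  assert (dby : forall x y, is_derive (fun z => b x z) y (ux x y * c x y))
    by (intros x; apply (hF x)).
  assert (dcy : forall x y,
    is_derive (fun z => c x z) y (- (exp (u x y) * a x y) - ux x y * b x y))
    by (intros x; apply (hF x)).
  assert (unit : forall x y, a x y ^ 2 + b x y ^ 2 + c x y ^ 2 = 1).
  { intros x y.
    rewrite (rotation_ode_norm _ _ _ _ _ (day x) (dby x) (dcy x)), a0, b0, c0.
    assert (n := rotation_ode_norm _ _ _ _ _ dA dC dB x).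
    rewrite A0, B0, C0 in n; lra. }
  clearbody a b c.
  assert (hor : forall x y,
    is_derive (fun z => a z y) x (exp (u x y) * b x y) /\
    is_derive (fun z => b z y) x (- (uy x y * c x y) - exp (u x y) * a x y) /\
    is_derive (fun z => c z y) x (uy x y * b x y)).
  { apply (frame_horizontal u ux uy uxx uyy); try assumption.
    - intros x; apply is_derive_ext with A; [intros; now rewrite a0 |].
      rewrite b0; apply dA.
    - intros x; apply is_derive_ext with B; [intros; now rewrite b0 |].
      rewrite a0, c0; eapply is_derive_eq; [apply dB | ring].
    - intros x; apply is_derive_ext with C; [intros; now rewrite c0 |].
      rewrite b0; apply dC. }
  exists a, b, c; split; [constructor; try assumption; intros x y; apply (hor x y) |].
  now rewrite a0.
Qed.

Lemma continuity_2d_locally_bounded (f : R -> R -> R) (x y : R) :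
  continuity_2d_pt f x y -> exists K, locally_2d (fun u v => Rabs (f u v) <= K) x y.
Proof.
  intros hf; exists (Rabs (f x y) + 1).
  destruct (hf (mkposreal 1 Rlt_0_1)) as [delta hd]; exists delta; intros s t hs ht.
  specialize (hd s t hs ht); simpl in hd.
  replace (f s t) with (f x y + (f s t - f x y)) by ring.
  apply Rabs_plus_le; [apply Rle_refl | left; exact hd].
Qed.

Lemma continuity_2d_of_bounded_partials (f fx fy : R -> R -> R) (x y K : R) :
  (forall x y, is_derive (fun z => f z y) x (fx x y)) ->
  (forall x y, is_derive (fun z => f x z) y (fy x y)) ->
  locally_2d (fun u v => Rabs (fx u v) <= K /\ Rabs (fy u v) <= K) x y ->
  continuity_2d_pt f x y.
Proof.
  intros hx hy [d0 hK] eps.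
  assert (K0 : 0 <= K).
  { destruct (hK x y) as [q _]; try (rewrite Rminus_diag, Rabs_R0; apply cond_pos).
    eapply Rle_trans; [apply Rabs_pos | exact q]. }
  assert (he : 0 < eps / (2 * (K + 1))) by (apply Rdiv_lt_0_compat; [apply cond_pos | lra]).
  exists (mkposreal _ (Rmin_pos _ _ (cond_pos d0) he)); simpl; intros s t hs ht.
  assert (s1 := Rlt_le_trans _ _ _ hs (Rmin_l _ _));
    assert (s2 := Rlt_le_trans _ _ _ hs (Rmin_r _ _)).
  assert (t1 := Rlt_le_trans _ _ _ ht (Rmin_l _ _));
    assert (t2 := Rlt_le_trans _ _ _ ht (Rmin_r _ _)).
  clear hs ht.
  assert (between : forall p q r, Rmin p q <= r <= Rmax p q ->
    Rabs (q - p) < d0 -> Rabs (r - p) < d0).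
  { intros p q r hr hq; apply Rle_lt_trans with (2 := hq).
    unfold Rmin, Rmax in hr; destruct Rle_dec;
      unfold Rabs; destruct Rcase_abs; destruct Rcase_abs; lra. }
  assert (b1 : Rabs (f s t - f x t) <= K * Rabs (s - x)).
  { apply (mean_value_bound (fun z => f z t) (fun z => fx z t)); [auto |].
    intros r hr; apply hK; [now apply between with s | exact t1]. }
  assert (b2 : Rabs (f x t - f x y) <= K * Rabs (t - y)).
  { apply (mean_value_bound (fun z => f x z) (fun z => fy x z)); [auto |].
    intros r hr; apply hK; [rewrite Rminus_diag, Rabs_R0; apply cond_pos | now apply between with t]. }
  replace (f s t - f x y) with ((f s t - f x t) + (f x t - f x y)) by ring.
  eapply Rle_lt_trans; [apply Rabs_plus_le; [exact b1 | exact b2] |].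
  assert (e : eps / (2 * (K + 1)) * (2 * (K + 1)) = eps) by (field; lra).
  set (e0 := eps / (2 * (K + 1))) in *.
  apply Rle_lt_trans with (K * e0 + K * e0).
  - apply Rplus_le_compat; apply Rmult_le_compat_l; lra.
  - lra.
Qed.

(** The components have absolute value at most 1, so the frame equations bound
    their partial derivatives locally. *)
Lemma sphere_frame_continuous (u ux uy uxx uyy a b c : R -> R -> R) (x y : R) :
  liouville_potential u ux uy uxx uyy -> sphere_frame u ux uy a b c ->
  continuity_2d_pt a x y /\ continuity_2d_pt b x y /\ continuity_2d_pt c x y.
Proof.
  intros [u_x u_y u_xx u_yy cu cux cuy cuxx pde] [ax bx cx ay by' cy unit].
  destruct (continuity_2d_locally_bounded _ x y (continuity_2d_exp_u u cu x y)) as [K1 h1].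
  destruct (continuity_2d_locally_bounded _ x y (cux x y)) as [K2 h2].
  destruct (continuity_2d_locally_bounded _ x y (cuy x y)) as [K3 h3].
  assert (bound : locally_2d (fun s t => Rabs (exp (u s t)) <= K1 /\
    Rabs (ux s t) <= K2 /\ Rabs (uy s t) <= K3) x y).
  { apply locally_2d_and; [exact h1 | apply locally_2d_and; assumption]. }
  destruct bound as [delta hd].
  assert (hK : 0 <= K1 /\ 0 <= K2 /\ 0 <= K3).
  { destruct (hd x y) as [q1 [q2 q3]]; try (rewrite Rminus_diag, Rabs_R0; apply cond_pos).
    split; [| split]; (eapply Rle_trans; [apply Rabs_pos | eassumption]). }
  split; [| split];
    [ apply (continuity_2d_of_bounded_partials _ _ _ x y (K1 * 1 + K2 * 1 + K3 * 1) ax ay)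
    | apply (continuity_2d_of_bounded_partials _ _ _ x y (K1 * 1 + K2 * 1 + K3 * 1) bx by')
    | apply (continuity_2d_of_bounded_partials _ _ _ x y (K1 * 1 + K2 * 1 + K3 * 1) cx cy) ];
    exists delta; intros s t hs ht; destruct (hd s t hs ht) as [q1 [q2 q3]];
    destruct (norm_one_components _ _ _ (unit s t)) as [na [nb nc]];
    assert (m1 := Rabs_mult_le _ _ _ _ q1 na); assert (m2 := Rabs_mult_le _ _ _ _ q1 nb);
    assert (m3 := Rabs_mult_le _ _ _ _ q1 nc); assert (m4 := Rabs_mult_le _ _ _ _ q2 nb);
    assert (m5 := Rabs_mult_le _ _ _ _ q2 nc); assert (m6 := Rabs_mult_le _ _ _ _ q3 nb);
    assert (m7 := Rabs_mult_le _ _ _ _ q3 nc);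
    apply Rabs_le_between in m1, m2, m3, m4, m5, m6, m7;
    split; apply Rabs_le; lra.
Qed.

(** The height satisfies [Lap a = - 2 exp (2 u) a] and
    [|grad a|^2 = exp (2 u) (1 - a^2)], whence
    [Lap (1 / (1 + a)) = 2 exp (2 u) / (1 + a)^2 > 0].  A lower bound on [1 + a]
    would bound this function. *)
Lemma sphere_frame_reaches_antipode (u ux uy uxx uyy a b c : R -> R -> R) (m : R) :
  liouville_potential u ux uy uxx uyy -> sphere_frame u ux uy a b c ->
  -1 < m -> exists x y, a x y < m.
Proof.
  intros lp sf hm.
  destruct (Classical_Prop.classic (exists x y, a x y < m)) as [| none]; [assumption | exfalso].
  assert (ha : forall x y, m <= a x y).
  { intros x y; apply Rnot_lt_le; intros q; apply none; now exists x, y. }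
  assert (hca : forall x y, continuity_2d_pt a x y)
    by (intros x y; apply (sphere_frame_continuous _ _ _ _ _ _ _ _ x y lp sf)).
  destruct lp as [u_x u_y u_xx u_yy cu cux cuy cuxx pde].
  destruct sf as [ax bx cx ay by' cy unit].
  assert (pos : forall x y, 0 < 1 + a x y) by (intros x y; specialize (ha x y); lra).
  assert (nz : forall x y, 1 + a x y <> 0) by (intros x y; specialize (pos x y); lra).
  assert (nz2 : forall x y, (1 + a x y) * (1 + a x y) <> 0)
    by (intros x y; apply Rmult_integral_contrapositive; auto).
  apply (subharmonic_unbounded (fun x y => 1 / (1 + a x y))
    (fun x y => - (exp (u x y) * b x y) / ((1 + a x y) * (1 + a x y)))
    (fun x y => - (exp (u x y) * c x y) / ((1 + a x y) * (1 + a x y)))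
    (fun x y => - (exp (u x y) * (ux x y * b x y - uy x y * c x y - exp (u x y) * a x y))
        / (1 + a x y) ^ 2 + 2 * (exp (u x y) * b x y) ^ 2 / (1 + a x y) ^ 3)
    (fun x y => - (exp (u x y) * (uy x y * c x y - ux x y * b x y - exp (u x y) * a x y))
        / (1 + a x y) ^ 2 + 2 * (exp (u x y) * c x y) ^ 2 / (1 + a x y) ^ 3))
    with (C := / (1 + m)).
  - intros x y; derive_by_rules; [apply nz | field; apply nz].
  - intros x y; derive_by_rules; [apply nz | field; apply nz].
  - intros x y; derive_by_rules; [apply nz2 | field; apply nz].
  - intros x y; derive_by_rules; [apply nz2 | field; apply nz].
  - intros x y; apply continuity_2d_pt_ext with (fun x y => / (1 + a x y)).
    { intros; unfold Rdiv; ring. }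
    apply continuity_2d_pt_inv; [| apply nz].
    apply continuity_2d_pt_plus; [apply continuity_2d_pt_const | apply hca].
  - intros x y.
    assert (e : c x y ^ 2 = 1 - a x y ^ 2 - b x y ^ 2) by (specialize (unit x y); lra).
    match goal with |- 0 < ?l => replace l with (2 * exp (u x y) ^ 2 / (1 + a x y) ^ 2) end.
    + assert (p := exp_pos (u x y)); specialize (pos x y).
      apply Rdiv_lt_0_compat; [apply Rmult_lt_0_compat; [lra |] |]; now apply pow_lt.
    + rewrite (Rpow_mult_distr _ (c x y)), e; field; apply nz.
  - intros x y; unfold Rdiv; rewrite Rmult_1_l; apply Rinv_le_contravar; [lra |].
    specialize (ha x y); lra.
Qed.

(** * Lengths of curves *)

Lemma is_derive_asin (x : R) : -1 < x < 1 -> is_derive asin x (1 / sqrt (1 - x²)).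
Proof.
  intros hx; apply is_derive_Reals.
  apply (derive_pt_eq_1 asin x _ (derivable_pt_asin x hx)), derive_pt_asin.
Qed.

Lemma smooth1_derive (p : R -> R) (t : R) :
  smooth1 p -> is_derive p t (Derive p t) /\ continuous (Derive p) t.
Proof.
  intros hp; split.
  - apply Derive_correct, (hp 1%nat).
  - apply (ex_derive_continuous (V := R_NormedModule) (Derive p)), (hp 2%nat).
Qed.

Section Length.
Variables u g gx gy : R -> R -> R.
Hypothesis cu : forall x y, continuity_2d_pt u x y.
Hypothesis dg : forall x y, differentiable_pt_lim g x y (gx x y) (gy x y).
Hypothesis grad_le : forall x y, gx x y ^ 2 + gy x y ^ 2 <= exp (u x y) ^ 2.

(** By the Cauchy-Schwarz inequality the integrand of the length dominates the
    derivative of [g] along the arc. *)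
Lemma smooth_arc_length_ge (p q : R -> R) (s t : R) :
  smooth1 p -> smooth1 q -> s <= t ->
  let speed := fun r => exp (u (p r) (q r)) * sqrt (Derive p r ^ 2 + Derive q r ^ 2) in
  ex_RInt speed s t /\ g (p t) (q t) - g (p s) (q s) <= RInt speed s t.
Proof.
  intros hp hq hst speed.
  assert (dp : forall r, is_derive p r (Derive p r)) by (intros r; now apply smooth1_derive).
  assert (dq : forall r, is_derive q r (Derive q r)) by (intros r; now apply smooth1_derive).
  assert (cs : forall r, continuous speed r).
  { intros r; apply (continuous_mult (fun r => exp (u (p r) (q r)))).
    - apply (continuous_comp (fun r => u (p r) (q r)) exp);
        [| apply continuity_pt_filterlim, derivable_continuous_pt, derivable_pt_exp].
      apply (continuous_comp_2 p q u).
      + apply (ex_derive_continuous (V := R_NormedModule) p); now eexists.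
      + apply (ex_derive_continuous (V := R_NormedModule) q); now eexists.
      + apply continuity_2d_pt_filterlim, cu.
    - apply continuous_sqrt_comp.
      apply (continuous_plus (fun r => Derive p r ^ 2) (fun r => Derive q r ^ 2)).
      + apply continuous_ext with (fun r => Derive p r * Derive p r); [intros; ring_R |].
        apply (continuous_mult (Derive p) (Derive p)); now apply smooth1_derive.
      + apply continuous_ext with (fun r => Derive q r * Derive q r); [intros; ring_R |].
        apply (continuous_mult (Derive q) (Derive q)); now apply smooth1_derive. }
  assert (ex : forall r, ex_RInt speed s r).
  { intros r; apply (ex_RInt_continuous (V := R_CompleteNormedModule)); auto. }
  split; [apply ex |].
  assert (h := nonneg_derivative_le
    (fun r => RInt speed s r - g (p r) (q r))
    (fun r => speed r - (gx (p r) (q r) * Derive p r + gy (p r) (q r) * Derive q r)) s t hst).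
  cbv beta in h.
  assert (h0 : RInt speed s s = 0) by apply (RInt_point (V := R_CompleteNormedModule)).
  rewrite h0 in h.
  apply Rminus_le; apply Rle_minus in h; [lra | |].
  - intros r _; apply is_derive_Rminus.
    + apply (is_derive_RInt speed _ s); [| apply cs].
      apply filter_forall; intros x; apply (RInt_correct (V := R_CompleteNormedModule)), ex.
    + apply is_derive_Reals, derivable_pt_lim_comp_2d; [apply dg | |]; apply is_derive_Reals; auto.
  - intros r _.
    assert (cs' := sqrt_cauchy (gx (p r) (q r)) (gy (p r) (q r)) (Derive p r) (Derive q r)).
    assert (hs : sqrt ((gx (p r) (q r))² + (gy (p r) (q r))²) <= exp (u (p r) (q r))).
    { rewrite <- (sqrt_pow2 (exp (u (p r) (q r)))) by (left; apply exp_pos).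
      apply sqrt_le_1_alt; unfold Rsqr; specialize (grad_le (p r) (q r)); lra. }
    apply (Rmult_le_compat_r (sqrt ((Derive p r)² + (Derive q r)²))) in hs; [| apply sqrt_pos].
    unfold speed; rewrite !Rsqr_pow2 in *; lra.
Qed.

Lemma conf_length_ge (c : R -> R * R) (a b : R) :
  piecewise_smooth c a b ->
  g (fst (c b)) (snd (c b)) - g (fst (c a)) (snd (c a)) <= conf_length u c a b.
Proof.
  intros [n [s [sa [sb [incr pieces]]]]].
  set (speed := fun t => exp (u (fst (c t)) (snd (c t))) *
                 sqrt (Derive (fun r => fst (c r)) t ^ 2 +
                       Derive (fun r => snd (c r)) t ^ 2)).
  assert (main : forall k, (k <= n)%nat ->
    ex_RInt speed (s 0%nat) (s k) /\
    g (fst (c (s k))) (snd (c (s k))) - g (fst (c (s 0%nat))) (snd (c (s 0%nat)))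
      <= RInt speed (s 0%nat) (s k)).
  { induction k as [|k IH]; intros hk.
    - split; [apply ex_RInt_point |].
      rewrite (RInt_point (V := R_CompleteNormedModule)); unfold zero; simpl; lra.
    - destruct (IH ltac:(lia)) as [ex1 le1].
      specialize (incr k ltac:(lia)).
      destruct (pieces k ltac:(lia)) as [p [q [hp [hq hc]]]].
      destruct (smooth_arc_length_ge p q (s k) (s (S k)) hp hq ltac:(lra)) as [ex2 le2].
      (* Inside a piece the coordinates of [c] agree near [t] with smooth functions,
         hence so do their derivatives. *)
      assert (ext : forall t, Rmin (s k) (s (S k)) < t < Rmax (s k) (s (S k)) ->
        exp (u (p t) (q t)) * sqrt (Derive p t ^ 2 + Derive q t ^ 2) = speed t).
      { intros t ht; rewrite Rmin_left, Rmax_right in ht by lra.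
        assert (loc : locally t (fun r => s k <= r <= s (S k))).
        { apply (locally_interval _ t (s k) (s (S k))); simpl; intros; lra. }
        assert (e1 : Derive (fun r : R => fst (c r)) t = Derive p t).
        { apply Derive_ext_loc, (filter_imp (fun r => s k <= r <= s (S k))); [| exact loc].
          intros r hr; now rewrite (hc r hr). }
        assert (e2 : Derive (fun r : R => snd (c r)) t = Derive q t).
        { apply Derive_ext_loc, (filter_imp (fun r => s k <= r <= s (S k))); [| exact loc].
          intros r hr; now rewrite (hc r hr). }
        unfold speed; rewrite e1, e2, (hc t) by lra; reflexivity. }
      assert (ex3 : ex_RInt speed (s k) (s (S k))) by exact (ex_RInt_ext _ _ _ _ ext ex2).
      rewrite (RInt_ext _ _ _ _ ext) in le2.
      split; [exact (ex_RInt_Chasles _ _ _ _ ex1 ex3) |].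
      assert (ch := RInt_Chasles (V := R_CompleteNormedModule) speed _ _ _ ex1 ex3).
      unfold plus in ch; simpl in ch.
      rewrite <- ch.
      assert (e1 := hc (s k) ltac:(lra)); assert (e2 := hc (s (S k)) ltac:(lra)).
      rewrite e2; rewrite e1 in le1; simpl in *; lra. }
  destruct (main n ltac:(lia)) as [_ h].
  rewrite sa, sb in h; exact h.
Qed.
End Length.

(** * The lower bound for the diameter *)

Lemma liouville_potential_of_smooth (u : R -> R -> R) :
  smooth2 u -> (forall x y, laplacian u x y + exp (2 * u x y) = 0) ->
  exists ux uy uxx uyy, liouville_potential u ux uy uxx uyy.
Proof.
  intros hu hL.
  set (ux := fun x y => Derive (fun z => u z y) x).
  set (uy := fun x y => Derive (fun z => u x z) y).
  exists ux, uy, (fun x y => Derive (fun z => ux z y) x), (fun x y => Derive (fun z => uy x z) y).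
  assert (h : forall x y, ex_diff_n u 2 x y) by (intros; apply hu).
  constructor; intros x y; destruct (h x y) as [c [ex [ey [hx hy]]]];
    destruct hx as [cx [exx [exy [[cxx _] _]]]]; destruct hy as [cy [eyx [eyy _]]].
  - now apply Derive_correct.
  - now apply Derive_correct.
  - now apply (Derive_correct (fun z => ux z y)).
  - now apply (Derive_correct (fun z => uy x z)).
  - exact c.
  - exact cx.
  - exact cy.
  - exact cxx.
  - rewrite <- (hL x y), <- exp_plus; unfold laplacian, partial_derive; simpl.
    f_equal; f_equal; ring.
Qed.

Section Distance.
Variables u ux uy uxx uyy a b c : R -> R -> R.
Hypothesis lp : liouville_potential u ux uy uxx uyy.
Hypothesis sf : sphere_frame u ux uy a b c.

Lemma height_differentiable x y :
  differentiable_pt_lim a x y (exp (u x y) * b x y) (exp (u x y) * c x y).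
Proof.
  apply filterdiff_differentiable_pt_lim.
  apply (is_derive_filterdiff a x y (fun x y => exp (u x y) * b x y)).
  - apply filter_forall; intros [s t]; apply (sf_ax _ _ _ _ _ _ sf).
  - apply (sf_ay _ _ _ _ _ _ sf).
  - apply (continuity_2d_pt_filterlim (fun x y => exp (u x y) * b x y)).
    apply continuity_2d_pt_mult.
    + apply continuity_2d_exp_u, (lp_c _ _ _ _ _ lp).
    + now apply (sphere_frame_continuous u ux uy uxx uyy a b c).
Qed.

(** Along any curve, [asin (l * a)] grows at most as fast as the length: the
    squared [g]-norm of its gradient is
    [l^2 (1 - a^2) / (1 - l^2 a^2)], which is at most 1. *)
Lemma dist_ge_asin (l : R) (P Q : R * R) :
  0 < l < 1 ->
  Rbar_le (asin (l * a (fst Q) (snd Q)) - asin (l * a (fst P) (snd P))) (conf_dist u P Q).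
Proof.
  intros hl.
  assert (range : forall x y, -1 < l * a x y < 1).
  { intros x y; destruct (norm_one_components _ _ _ (sf_unit _ _ _ _ _ _ sf x y)) as [h _].
    apply Rabs_lt_between; rewrite Rabs_mult, (Rabs_pos_eq l) by lra.
    assert (l * Rabs (a x y) <= l * 1) by (apply Rmult_le_compat_l; lra); lra. }
  assert (disc : forall x y, 0 < 1 - (l * a x y)²).
  { intros x y; destruct (range x y); unfold Rsqr; nra. }
  set (k := fun x y => l * (1 / sqrt (1 - (l * a x y)²))).
  assert (k2 : forall x y, k x y ^ 2 * (1 - (l * a x y)²) = l ^ 2).
  { intros x y; specialize (disc x y).
    assert (hs := sqrt_lt_R0 _ disc).
    unfold k; rewrite <- (pow2_sqrt (1 - (l * a x y)²)) at 2 by lra; field; lra. }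
  apply (proj2 (Glb_Rbar_correct _)).
  intros r [g [s [t [_ [hg [hgs [hgt ->]]]]]]].
  rewrite <- hgs, <- hgt.
  apply (conf_length_ge u (fun x y => asin (l * a x y))
    (fun x y => k x y * (exp (u x y) * b x y)) (fun x y => k x y * (exp (u x y) * c x y)));
    [apply (lp_c _ _ _ _ _ lp) | | | exact hg]; intros x y.
  - replace (k x y * (exp (u x y) * b x y))
      with (k x y * (exp (u x y) * b x y) + 0 * (exp (u x y) * b x y)) by ring.
    replace (k x y * (exp (u x y) * c x y))
      with (k x y * (exp (u x y) * c x y) + 0 * (exp (u x y) * c x y)) by ring.
    apply (differentiable_pt_lim_comp (fun z _ => asin (l * z)) a a);
      try apply height_differentiable.
    apply differentiable_pt_lim_proj1_0, is_derive_Reals.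
    apply (is_derive_comp asin (fun z => l * z)).
    + apply is_derive_asin, range.
    + derive_by_rules; ring.
  - assert (n := sf_unit _ _ _ _ _ _ sf x y).
    assert (e : k x y ^ 2 * (1 - a x y ^ 2) <= 1).
    { specialize (k2 x y); specialize (disc x y).
      apply Rmult_le_reg_r with (1 - (l * a x y)²); [exact disc |].
      replace (k x y ^ 2 * (1 - a x y ^ 2) * (1 - (l * a x y)²))
        with (l ^ 2 * (1 - a x y ^ 2)) by (rewrite <- k2; ring).
      unfold Rsqr; assert (l ^ 2 <= 1) by nra; lra. }
    replace ((k x y * (exp (u x y) * b x y)) ^ 2 + (k x y * (exp (u x y) * c x y)) ^ 2)
      with (k x y ^ 2 * (1 - a x y ^ 2) * exp (u x y) ^ 2).
    + rewrite <- (Rmult_1_l (exp (u x y) ^ 2)) at 2.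
      apply Rmult_le_compat_r; [apply pow2_ge_0 | exact e].
    + replace (1 - a x y ^ 2) with (b x y ^ 2 + c x y ^ 2) by lra; ring.
Qed.
End Distance.

Lemma asin_le_opp (w t : R) :
  -1 <= w -> w <= - sin t -> 0 <= t <= PI / 2 -> asin w <= - t.
Proof.
  intros hw hwt ht.
  assert (hs := sin_ge_0 t ltac:(lra) ltac:(lra)).
  apply Rnot_lt_le; intros q.
  assert (hb := asin_bound w).
  apply sin_increasing_1 in q; try lra.
  rewrite sin_asin, sin_neg in q by lra; lra.
Qed.

Theorem theorem1p1 (u : R -> R -> R)
  (hu : smooth2 u)
  (hL : forall x y : R, laplacian u x y + exp (2 * u x y) = 0) :
  Rbar_le PI (conf_diam u).
Proof.
  destruct (liouville_potential_of_smooth u hu hL) as [ux [uy [uxx [uyy lp]]]].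
  destruct (sphere_frame_exists u ux uy uxx uyy lp) as [a [b [c [sf a0]]]].
  assert (hpi := PI_RGT_0).
  assert (key : forall t, 0 < t < PI / 2 -> Rbar_lt (2 * t) (conf_diam u)).
  { intros t ht.
    (* With [l = sin th], the function [asin (l * a)] is [th > t] at the origin and
       at most [- t] at a point of height below [- sin t / sin th], which is
       greater than -1. *)
    set (th := (t + PI / 2) / 2).
    assert (hth : t < th < PI / 2) by (unfold th; lra).
    assert (s1 : 0 < sin t) by (apply sin_gt_0; lra).
    assert (s2 : sin t < sin th) by (apply sin_increasing_1; lra).
    assert (s3 : sin th < 1) by (rewrite <- sin_PI2; apply sin_increasing_1; lra).
    destruct (sphere_frame_reaches_antipode u ux uy uxx uyy a b c (- (sin t / sin th)) lp sf)
      as [x [y hxy]].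
    { assert (q : sin t / sin th < 1); [| lra].
      apply Rmult_lt_reg_r with (sin th); [lra |].
      unfold Rdiv; rewrite Rmult_assoc, Rinv_l by lra; lra. }
    assert (hd := dist_ge_asin u ux uy uxx uyy a b c lp sf (sin th) (x, y) (0, 0) ltac:(lra)).
    simpl fst in hd; simpl snd in hd; rewrite a0, Rmult_1_r, asin_sin in hd by lra.
    assert (low : asin (sin th * a x y) <= - t).
    { destruct (norm_one_components _ _ _ (sf_unit _ _ _ _ _ _ sf x y)) as [n _].
      apply Rabs_le_between in n.
      apply asin_le_opp; [| | lra].
      - assert (sin th * -1 <= sin th * a x y) by (apply Rmult_le_compat_l; lra); lra.
      - replace (- sin t) with (sin th * - (sin t / sin th)) by (field; lra).
        apply Rmult_le_compat_l; lra. }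
    apply Rbar_lt_le_trans with (th - asin (sin th * a x y)); [simpl; lra |].
    apply Rbar_le_trans with (1 := hd).
    apply (proj1 (proj2_sig (Rbar_ex_lub
      (fun d : Rbar => exists x y : R * R, d = conf_dist u x y)))).
    now exists (x, y), (0, 0). }
  destruct (conf_diam u) as [r | |].
  - simpl; apply Rnot_lt_le; intros q.
    assert (k := key ((Rmax r 0 + PI) / 4)); simpl in k.
    assert (m1 := Rmax_l r 0); assert (m2 := Rmax_r r 0).
    assert (m3 : Rmax r 0 < PI) by (apply Rmax_lub_lt; lra).
    lra.
  - exact I.
  - apply (key (PI / 4)); lra.
Qed.
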